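(* Let $\phi_1,\dots,\phi_n:\mathbb{R}^m\to\mathbb{R}$ be convex, differentiable with $(1/\gamma)$-Lipschitz gradients ($\gamma>0$), let $g:\mathbb{R}^d\to\mathbb{R}$ be $1$-strongly convex, $\lambda>0$, and let $A_1,\dots,A_n\in\mathbb{R}^{d\times m}$ be nonzero. Let $c\ge1$ be an integer dividing $n$, let $\mathcal{P}_1,\dots,\mathcal{P}_c$ be a partition of $[n]$ into sets of equal size $n/c$, and let $\tau\in\{1,\dots,n/c\}$. Suppose the algorithm Quartz (described in the context) is run with $\hat S$ the $(c,\tau)$-distributed sampling and $$v_i=\lambda_{\max}\left(\sum_{j=1}^d\left(1+\frac{(\tau-1)(\omega_j-1)}{\max\{\frac nc-1,1\}}+\left(\frac{\tau c}{n}-\frac{\tau-1}{\max\{\frac nc-1,1\}}\right)\frac{\omega_j'-1}{\omega_j'}\omega_j\right)A_{ji}^\top A_{ji}\right),\quad i\in[n],$$ where $A_{ji}\in\mathbb{R}^{1\times m}$ is the $j$-th row of $A_i$, $\omega_j=|\{i\in[n]:A_{ji}\ne0\}|$ and $\omega_j'=|\{l\in[c]:\{i\in\mathcal{P}_l:A_{ji}\ne0\}\ne\emptyset\}|$ (terms with $\omega_j'=0$, for which all $A_{ji}=0$, being omitted from the sum). If $0<\epsilon\le P(w^0)-D(\alpha^0)$ and the integer $T$ satisfies $$T\ge T(c,\tau)\,\log\left(\frac{P(w^0)-D(\alpha^0)}{\epsilon}\right),\qquad T(c,\tau):=\frac{n}{c\tau}+\max_{i\in[n]}\frac{v_i}{\lambda\gamma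 c\tau},$$ then $\mathbb{E}[P(w^T)-D(\alpha^T)]\le\epsilon$.
   Context: $[n]=\{1,\dots,n\}$; $\|\cdot\|$ is the Euclidean norm. The $(c,\tau)$-distributed sampling associated with $\mathcal{P}_1,\dots,\mathcal{P}_c$ is $\hat S=\bigcup_{l=1}^c\hat S_l$, where $\hat S_1,\dots,\hat S_c$ are independent and $\hat S_l$ is a subset of $\mathcal{P}_l$ of cardinality $\tau$ chosen uniformly at random; hence $p_i=\mathbb{P}(i\in\hat S)=c\tau/n$. $g$ is $1$-strongly convex means $g(w)\ge g(w')+\langle s,w-w'\rangle+\tfrac12\|w-w'\|^2$ for all $w,w'$ and every subgradient $s$ of $g$ at $w'$. $\xi^*(u)=\sup_s\{\langle s,u\rangle-\xi(s)\}$ is the convex (Fenchel) conjugate (possibly $+\infty$ for $\phi_i^*$; $g^*$ is finite and $1$-smooth). The primal and dual objectives are $$P(w)=\frac1n\sum_{i=1}^n\phi_i(A_i^\top w)+\lambda g(w),\quad w\in\mathbb{R}^d,$$ $$D(\alpha)=-\lambda g^*\Big(\frac1{\lambda n}\sum_{i=1}^nA_i\alpha_i\Big)-\frac1n\sum_{i=1}^n\phi_i^*(-\alpha_i),\quad \alpha=(\alpha_1,\dots,\alpha_n)\in(\mathbb{R}^m)^n.$$ Algorithm Quartz (with random set $\hat S\subseteq[n]$, $p_i=\mathbb{P}(i\in\hat S)>0$, and positive vector $v\in\mathbb{R}^n$): choose $\alpha^0\in(\mathbb{R}^m)^n$, $w^0\in\mathbb{R}^d$ (deterministic); set $\theta=\min_i\frac{p_i\lambda\gamma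 n}{v_i+\lambda\gamma n}$ and $\bar\alpha^0=\frac1{\lambda n}\sum_iA_i\alpha_i^0$. For $t=1,2,\dots$: (1) $w^t=(1-\theta)w^{t-1}+\theta\nabla g^*(\bar\alpha^{t-1})$; (2) draw a random set $S_t\subseteq[n]$ with the distribution of $\hat S$, independently of all previous draws; (3) for $i\notin S_t$ put $\alpha_i^t=\alpha_i^{t-1}$; for $i\in S_t$ put $\alpha_i^t=\alpha_i^{t-1}+\Delta\alpha_i^t$, where $\Delta\alpha_i^t$ is given by one of the two options (the result holds for either option): Option I: $\Delta\alpha_i^t=\arg\max_{\Delta\in\mathbb{R}^m}\big[-\phi_i^*(-(\alpha_i^{t-1}+\Delta))-\nabla g^*(\bar\alpha^{t-1})^\top A_i\Delta-\frac{v_i\|\Delta\|^2}{2\lambda n}\big]$; Option II: $\Delta\alpha_i^t=-\theta p_i^{-1}\alpha_i^{t-1}-\theta p_i^{-1}\nabla\phi_i(A_i^\top w^t)$; (4) $\bar\alpha^t=\bar\alpha^{t-1}+\frac1{\lambda n}\sum_{i\in S_t}A_i\Delta\alpha_i^t$ (so $\bar\alpha^t=\frac1{\lambda n}\sum_iA_i\alpha_i^t$). *)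

(* Defs.v *)
From HB Require Import structures.
From mathcomp Require Import all_boot all_order all_algebra.
From mathcomp Require Import all_classical all_reals all_analysis.

Set Implicit Arguments.
Unset Strict Implicit.
Unset Printing Implicit Defensive.

Import Order.TTheory GRing.Theory Num.Theory.
Import numFieldNormedType.Exports.

Local Open Scope classical_set_scope.
Local Open Scope ring_scope.

(* Vectors are column vectors. The library norm on
   matrices is the sup norm, hence the separate Euclidean norm below;
   differentiability does not depend on the choice of norm. *)

Definition dotv (R : realType) (k : nat) (x y : 'cV[R]_k) : R :=
  \sum_(i < k) x i 0 * y i 0.

Definition enorm (R : realType) (k : nat) (x : 'cV[R]_k) : R :=
  Num.sqrt (dotv x x).

Definition gradient (R : realType) (k : nat) (f : 'cV[R]_k -> R)
    (x : 'cV[R]_k) : 'cV[R]_k :=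
  \col_(i < k) derive (f : 'cV[R]_k -> R^o) x (delta_mx i 0).

Definition convex (R : realType) (k : nat) (f : 'cV[R]_k -> R) : Prop :=
  @convex_function R 'cV[R]_k setT f.

Definition lipschitz_gradient (R : realType) (k : nat) (L : R)
    (f : 'cV[R]_k -> R) : Prop :=
  (forall x, differentiable (f : 'cV[R]_k -> R^o) x) /\
  (forall x y, enorm (gradient f x - gradient f y) <= L * enorm (x - y)).

Definition subgradient (R : realType) (k : nat) (f : 'cV[R]_k -> R)
    (x s : 'cV[R]_k) : Prop :=
  forall y, f x + dotv s (y - x) <= f y.

(* Convexity is part of the definition: the second clause alone would hold
   vacuously for a function without subgradients. *)
Definition strongly_convex1 (R : realType) (k : nat) (g : 'cV[R]_k -> R)
    : Prop :=
  convex g /\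
  forall w w' s, subgradient g w' s ->
    g w' + dotv s (w - w') + 2^-1 * enorm (w - w') ^+ 2 <= g w.

Definition conjugate (R : realType) (k : nat) (f : 'cV[R]_k -> R)
    (u : 'cV[R]_k) : \bar R :=
  ereal_sup (range (fun s : 'cV[R]_k => (dotv s u - f s)%:E)).

(* [fine] is harmless where it is used: the conjugate of a 1-strongly convex
   finite function is finite everywhere. *)
Definition grad_conjugate (R : realType) (k : nat) (f : 'cV[R]_k -> R)
    : 'cV[R]_k -> 'cV[R]_k :=
  gradient (fun u => fine (conjugate f u)).

Definition lambda_max (R : realType) (k : nat) (M : 'M[R]_k) : R :=
  sup [set a : R | eigenvalue M a].

Section Objectives.
Variables (R : realType) (n d m : nat).
Variables (phi : 'I_n -> 'cV[R]_m -> R) (g : 'cV[R]_d -> R).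
Variables (A : 'I_n -> 'M[R]_(d, m)) (lambda : R).

Definition primal (w : 'cV[R]_d) : R :=
  n%:R^-1 * (\sum_(i < n) phi i ((A i)^T *m w)) + lambda * g w.

Definition dual_average (alpha : 'I_n -> 'cV[R]_m) : 'cV[R]_d :=
  (lambda * n%:R)^-1 *: \sum_(i < n) A i *m alpha i.

Definition dual (alpha : 'I_n -> 'cV[R]_m) : \bar R :=
  (- (lambda%:E * conjugate g (dual_average alpha))
   - (n%:R^-1)%:E * \sum_(i < n) conjugate (phi i) (- alpha i))%E.

End Objectives.

Section RandomSets.
Variables (R : realType) (n : nat).

Definition random_set (dT : measure_display) (T : measurableType dT)
    (X : T -> {set 'I_n}) : Prop :=
  forall s : {set 'I_n}, measurable [set x | X x = s].

Definition mutually_independent (dT : measure_display)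
    (T : measurableType dT) (P : probability T R) (I : choiceType)
    (X : I -> T -> {set 'I_n}) : Prop :=
  forall (J : seq I) (B : I -> set {set 'I_n}), uniq J ->
    P [set x | forall i, i \in J -> B i (X i x)] =
    (\prod_(i <- J) P [set x | B i (X i x)])%E.

Definition uniform_subset (dT : measure_display) (T : measurableType dT)
    (P : probability T R) (Q : {set 'I_n}) (tau : nat)
    (X : T -> {set 'I_n}) : Prop :=
  random_set X /\
  forall s : {set 'I_n}, P [set x | X x = s] =
    (if (s \subset Q) && (#|s| == tau)
     then ('C(#|Q|, tau)%:R^-1)%:E else 0%E).

Definition equipartition (c : nat) (Part : 'I_c -> {set 'I_n}) : Prop :=
  (forall i, exists! l, i \in Part l) /\ (forall l, #|Part l| = n %/ c)%N.

Definition distributed_sampling (dT : measure_display)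
    (T : measurableType dT) (P : probability T R)
    (c tau : nat) (Part : 'I_c -> {set 'I_n}) (Shat : T -> {set 'I_n})
    : Prop :=
  exists Sl : 'I_c -> T -> {set 'I_n},
    [/\ forall l, uniform_subset P (Part l) tau (Sl l),
        mutually_independent P Sl &
        forall x, Shat x = (\bigcup_(l < c) Sl l x)%SET].

Definition iid_copies (dT dT' : measure_display)
    (T : measurableType dT) (P : probability T R)
    (T' : measurableType dT') (P' : probability T' R)
    (X : nat -> T -> {set 'I_n}) (Y : T' -> {set 'I_n}) : Prop :=
  [/\ forall t, random_set (X t),
      mutually_independent P X &
      forall t s, P [set x | X t x = s] = P' [set y | Y y = s]].

End RandomSets.

Section Weights.
Variables (R : realType) (n d m c : nat).
Variables (A : 'I_n -> 'M[R]_(d, m)) (Part : 'I_c -> {set 'I_n}) (tau : nat).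

Definition omega (j : 'I_d) : nat :=
  #|([set i : 'I_n | row j (A i) != 0%R])%SET|.

Definition omega' (j : 'I_d) : nat :=
  #|([set l : 'I_c | [exists i in Part l, row j (A i) != 0%R]])%SET|.

Definition block_ratio : R :=
  (tau%:R - 1) / Num.max (n%:R / c%:R - 1) 1.

Definition row_weight (j : 'I_d) : R :=
  1 + block_ratio * ((omega j)%:R - 1)
  + (tau%:R * c%:R / n%:R - block_ratio)
    * (((omega' j)%:R - 1) / (omega' j)%:R) * (omega j)%:R.

Definition distributed_v (i : 'I_n) : R :=
  lambda_max (\sum_(j < d | omega' j != 0%N)
    row_weight j *: ((row j (A i))^T *m row j (A i))).

End Weights.

Inductive quartz_option := OptionI | OptionII.

Section Quartz.
Variables (R : realType) (n d m : nat).
Variables (phi : 'I_n -> 'cV[R]_m -> R) (g : 'cV[R]_d -> R).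
Variables (A : 'I_n -> 'M[R]_(d, m)) (lambda gamma : R).
Variables (p v : 'I_n -> R).

(* For n >= 1 this infimum is a minimum. *)
Definition quartz_theta : R :=
  inf (range (fun i : 'I_n =>
    p i * lambda * gamma * n%:R / (v i + lambda * gamma * n%:R))).

Definition optionI_objective (i : 'I_n) (abar : 'cV[R]_d)
    (a delta : 'cV[R]_m) : \bar R :=
  (- conjugate (phi i) (- (a + delta))%R
   - (dotv (grad_conjugate g abar) (A i *m delta))%:E
   - (v i * enorm delta ^+ 2 / (2 * lambda * n%:R))%:E)%E.

(* [a], [abar] are the values before the iteration, [w] is the new primal
   iterate. *)
Definition quartz_increment (o : quartz_option) (i : 'I_n) (w abar : 'cV[R]_d)
    (a delta : 'cV[R]_m) : Prop :=
  match o with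
  | OptionI => forall delta',
      (optionI_objective i abar a delta' <= optionI_objective i abar a delta)%E
  | OptionII =>
      delta = - (quartz_theta / p i) *: a
              - (quartz_theta / p i) *: gradient (phi i) ((A i)^T *m w)
  end.

(* A realisation of the algorithm for a realisation [S 1, S 2, ...] of the
   sampled sets; [S 0] and [delta 0] are not used. *)
Record quartz_run (o : quartz_option) (w0 : 'cV[R]_d)
    (alpha0 : 'I_n -> 'cV[R]_m) (S : nat -> {set 'I_n}) (w abar : nat -> 'cV[R]_d)
    (alpha delta : nat -> 'I_n -> 'cV[R]_m) : Prop := QuartzRun {
  quartz_w0 : w 0%N = w0;
  quartz_alpha0 : forall i, alpha 0%N i = alpha0 i;
  quartz_abar0 : abar 0%N = dual_average A lambda alpha0;
  quartz_w : forall t, w t.+1 =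
    (1 - quartz_theta) *: w t + quartz_theta *: grad_conjugate g (abar t);
  quartz_delta : forall t i, i \in S t.+1 ->
    quartz_increment o i (w t.+1) (abar t) (alpha t i) (delta t.+1 i);
  quartz_alpha : forall t i, alpha t.+1 i =
    if i \in S t.+1 then alpha t i + delta t.+1 i else alpha t i;
  quartz_abar : forall t, abar t.+1 =
    abar t + (lambda * n%:R)^-1 *: \sum_(i in S t.+1) A i *m delta t.+1 i }.

(* For n >= 1 the supremum is a maximum. *)
Definition quartz_complexity (c tau : nat) : R :=
  n%:R / (c%:R * tau%:R)
  + sup (range (fun i : 'I_n => v i / (lambda * gamma * c%:R * tau%:R))).

End Quartz.

(* Main.v *)
Require Import Defs.
From HB Require Import structures.
From mathcomp Require Import all_boot all_order all_algebra.
From mathcomp Require Import all_classical all_reals all_analysis.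
From mathcomp Require Import measurable_realfun ring lra.
Import Order.TTheory GRing.Theory Num.Theory.
Import numFieldNormedType.Exports.
Set Implicit Arguments.
Unset Strict Implicit.
Unset Printing Implicit Defensive.
Local Open Scope ring_scope.

(* Write G_t for the duality gap after t steps. Smoothness of g^* bounds g^*(abar^t) by a quadratic in the sampled
   increments; its expected value is separable, by the inequality
   E |sum_{i in S} A_i h_i|^2 <= sum_i p_i v_i |h_i|^2, which is where the
   weights v_i come from: row by row, the second moments of the block sampling
   are explicit, and Cauchy-Schwarz is used over the omega_j columns and over
   the omega'_j blocks meeting the row. The increments then decouple; Option I
   maximises the resulting bound, so it is enough to treat the increment of
   Option II, which moves -alpha_i towards the gradient of phi_i by the fraction
   theta / p_i. There the gamma-strong convexity of phi_i^* absorbs the quadratic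
   term by the choice of theta, and convexity of phi_i and g gives
   E [G_t | S_1, ..., S_(t-1)] <= (1 - theta) G_(t-1). Finally
   1 / theta = T(c, tau). *)

(** * Uniform and distributed samplings *)

(** Two obstacles shape the argument. First, [conjugate] is extended-real, so the dual may be [-oo].
    The contraction is carried out on the real number [real_gap], and finiteness of each conjugate
    at [- alpha t x i] is propagated along the run; an infinite initial gap is excluded because the
    bound on [T] would then read [+oo <= T]. Second, the iterates are arbitrary functions on [Omega]
    obeying the update rules, with no measurability given, and Option I only asks for some
    maximiser. Strong convexity of the conjugates makes that maximiser unique, so the iterates after
    [t] steps are functions of the first [t] sampled sets, which take finitely many values: every
    expectation is a finite sum and conditioning is summation over histories. On the analytic side
    no biconjugation is used. Strong convexity of the conjugate of [phi i] comes from testing its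
    supremum at shifted points, and the conjugate of [g] is differentiated by squeezing it between
    its tangent and the tangent plus half the squared norm. *)

Section UniformSubset.
Variables (R : realType) (n : nat) (Q : {set 'I_n}) (tau : nat).
Hypothesis tau_le : (1 <= tau <= #|Q|)%N.
Implicit Types (s : {set 'I_n}) (x : 'I_n -> R).

Definition uniform_weight s : R :=
  if (s \subset Q) && (#|s| == tau) then 'C(#|Q|, tau)%:R^-1 else 0.

Lemma bin_neq0 : 'C(#|Q|, tau)%:R != 0 :> R.
Proof. by rewrite pnatr_eq0 -lt0n bin_gt0; case/andP: tau_le. Qed.

Lemma card_neq0 : #|Q|%:R != 0 :> R.
Proof. by rewrite pnatr_eq0 -lt0n; case/andP: tau_le => /leq_trans; apply. Qed.

(* Subsets avoiding [B] are those of [Q :\: B]; the inclusion probabilities below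
   follow from this count by inclusion-exclusion. *)
Lemma sum_uniform_weight_avoiding (B : {set 'I_n}) : B \subset Q ->
  \sum_s uniform_weight s * [disjoint s & B]%:R =
  'C(#|Q| - #|B|, tau)%:R / 'C(#|Q|, tau)%:R.
Proof.
move=> BQ.
have -> : (#|Q| - #|B|)%N = #|Q :\: B| by rewrite cardsD (finset.setIidPr BQ).
rewrite -cards_draws -sum1_card natr_sum mulr_suml [RHS]big_mkcond/=.
apply: eq_bigr => s _; rewrite inE subsetD /uniform_weight.
by case: (s \subset Q); case: [disjoint _ & _]; case: (#|s| == tau);
  rewrite ?(mulr0, mulr1, mul0r, mul1r).
Qed.

Lemma sum_uniform_weight : \sum_s uniform_weight s = 1.
Proof.
have := sum_uniform_weight_avoiding (finset.sub0set Q); rewrite cards0 subn0 divff ?bin_neq0//.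
by move=> <-; apply: eq_bigr => s _; rewrite disjoint_sym finset.disjoints_subset finset.sub0set mulr1.
Qed.

(** This is the probability of missing one given element of [Q]. *)
Lemma bin_ratio1 : 'C(#|Q| - 1, tau)%:R / 'C(#|Q|, tau)%:R = 1 - tau%:R / #|Q|%:R :> R.
Proof.
have /(congr1 (fun k => k%:R : R)) := mul_bin_down #|Q| tau.
case/andP: tau_le => _ t2; rewrite !natrM natrB// subn1 => H.
apply: (mulfI card_neq0); rewrite mulrA H mulfK ?bin_neq0// mulrBr mulr1.
by rewrite mulrCA divff ?mulr1 // card_neq0.
Qed.

Lemma bin_ratio2 : (2 <= #|Q|)%N ->
  'C(#|Q| - 2, tau)%:R / 'C(#|Q|, tau)%:R =
  (1 - tau%:R / #|Q|%:R) * (1 - tau%:R / (#|Q|%:R - 1)) :> R.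
Proof.
move=> Q2; have q1 : #|Q|%:R - 1 != 0 :> R.
  by rewrite -[1]/(1%:R) -natrB ?pnatr_eq0 -?lt0n ?subn_gt0// ltnW.
have /(congr1 (fun k => k%:R : R)) := mul_bin_down (#|Q| - 1)%N tau.
rewrite -bin_ratio1 !natrM (_ : (#|Q| - 1).-1 = #|Q| - 2)%N; last by rewrite -subn1 -subnDA.
(* For [tau = #|Q|] the natural subtraction truncates to 0 while the real one is -1; the binomial
   factor vanishes there, so the two sides still agree. *)
have -> : ((#|Q| - 1 - tau)%:R * 'C(#|Q| - 1, tau)%:R : R) =
  (#|Q|%:R - 1 - tau%:R) * 'C(#|Q| - 1, tau)%:R.
  have [t|t] := leqP tau (#|Q| - 1); first by rewrite !natrB// ltnW.
  by rewrite bin_small// !mulr0.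
rewrite (natrB _ (ltnW Q2)) => H.
rewrite mulrAC; congr (_ / _); apply: (mulfI q1); rewrite H.
move: q1; move: (#|Q|%:R : R) (tau%:R : R) ('C(_, _)%:R) => q t C q1.
by field.
Qed.

Lemma uniform_weight_mem i : i \in Q ->
  \sum_s uniform_weight s * (i \in s)%:R = tau%:R / #|Q|%:R.
Proof.
move=> iQ; have := sum_uniform_weight_avoiding (_ : [set i] \subset Q).
rewrite finset.sub1set cards1 bin_ratio1 => /(_ iQ) H.
have : \sum_s uniform_weight s * (i \in s)%:R + \sum_s uniform_weight s * [disjoint s & [set i]]%:R = 1.
  rewrite -big_split -[RHS]sum_uniform_weight; apply: eq_bigr => s _ /=.
  by rewrite disjoint_sym finset.disjoints1; case: (i \in s); rewrite /= ?mulr1 ?mulr0 ?addr0 ?add0r.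
by rewrite H; lra.
Qed.

Lemma uniform_weight_mem2 i k : i \in Q -> k \in Q -> i != k ->
  \sum_s uniform_weight s * ((i \in s)%:R * (k \in s)%:R) =
  tau%:R / #|Q|%:R * ((tau%:R - 1) / (#|Q|%:R - 1)).
Proof.
move=> iQ kQ ik.
have ikQ : [set i; k] \subset Q.
  by apply/fintype.subsetP => j; rewrite !inE => /orP[]/eqP->.
have Q2 : (2 <= #|Q|)%N by have := subset_leq_card ikQ; rewrite cards2 ik.
have q1 : #|Q|%:R - 1 != 0 :> R.
  by rewrite -[1]/(1%:R) -natrB ?pnatr_eq0 -?lt0n ?subn_gt0// ltnW.
have := sum_uniform_weight_avoiding ikQ; rewrite cards2 ik bin_ratio2// => H.
(* Inclusion-exclusion: the indicator of both, plus 1, equals the two single indicators plus the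
   indicator of neither. *)
have : \sum_s uniform_weight s * ((i \in s)%:R * (k \in s)%:R) + 1
  = \sum_s uniform_weight s * (i \in s)%:R + \sum_s uniform_weight s * (k \in s)%:R
  + \sum_s uniform_weight s * [disjoint s & [set i; k]]%:R.
  rewrite -[X in _ + X = _]sum_uniform_weight -!big_split; apply: eq_bigr => s _ /=.
  rewrite disjoint_sym finset.disjoints_subset finset.subUset !finset.sub1set !inE.
  by case: (i \in s); case: (k \in s) => /=; ring.
rewrite H !uniform_weight_mem// => E; apply: (addIr 1); rewrite E; field.
by rewrite q1 card_neq0.
Qed.

(** The conditional probability that a second given element of [Q] is drawn once a first one is. The
    maximum with 1 only acts when [Q] is a singleton; then [tau = 1] and the value is 0. *)
Definition block_factor : R := (tau%:R - 1) / Num.max (#|Q|%:R - 1) 1.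

Lemma uniform_weight_sum x :
  \sum_s uniform_weight s * (\sum_(i in s) x i) = tau%:R / #|Q|%:R * \sum_(i in Q) x i.
Proof.
transitivity (\sum_(i in Q) x i * \sum_s uniform_weight s * (i \in s)%:R).
  under eq_bigr do rewrite mulr_sumr.
  under [RHS]eq_bigr do rewrite mulr_sumr.
  rewrite [RHS]exchange_big; apply: eq_bigr => s _ /=.
  rewrite [LHS]big_mkcond [RHS]big_mkcond; apply: eq_bigr => i _ /=.
  rewrite /uniform_weight.
  have [/andP[/fintype.subsetP sQ _]|_] := boolP ((s \subset Q) && _).
    by have [/sQ ->|_] := boolP (i \in s); rewrite ?mulr0 ?if_same// mulr1 mulrC.
  by rewrite !(mul0r, mulr0) !if_same.
by rewrite mulr_sumr; apply: eq_bigr => i iQ; rewrite uniform_weight_mem// mulrC.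
Qed.

(** Expanding the square, a diagonal pair has weight [p] and an off-diagonal pair weight [p * b];
    completing the off-diagonal sum to the full square leaves [1 - b] on the diagonal. *)
Lemma uniform_weight_sqr x :
  \sum_s uniform_weight s * (\sum_(i in s) x i) ^+ 2 =
  tau%:R / #|Q|%:R * ((1 - block_factor) * (\sum_(i in Q) x i ^+ 2)
     + block_factor * (\sum_(i in Q) x i) ^+ 2).
Proof.
transitivity (\sum_(i in Q) \sum_(k in Q)
    x i * x k * \sum_s uniform_weight s * ((i \in s)%:R * (k \in s)%:R)).
  transitivity (\sum_s uniform_weight s *
    (\sum_(i in Q) \sum_(k in Q) x i * x k * ((i \in s)%:R * (k \in s)%:R))).
    apply: eq_bigr => s _; rewrite /uniform_weight.
    case: ifPn => [/andP[sQ _]|_]; last by rewrite !mul0r.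
    have E : \sum_(i in s) x i = \sum_(i in Q) x i * (i \in s)%:R.
      rewrite [LHS]big_mkcond [RHS]big_mkcond; apply: eq_bigr => i _.
      have [/(fintype.subsetP sQ) ->|_] := boolP (i \in s); first by rewrite mulr1.
      by rewrite mulr0 if_same.
    rewrite expr2 E mulr_suml; congr (_ * _); apply: eq_bigr => i _.
    by rewrite mulr_sumr; apply: eq_bigr => k _; rewrite mulrACA.
  under eq_bigr do rewrite mulr_sumr; rewrite exchange_big; apply: eq_bigr => i _ /=.
  under eq_bigr do rewrite mulr_sumr; rewrite exchange_big; apply: eq_bigr => k _ /=.
  by rewrite mulr_sumr; apply: eq_bigr => s _; rewrite mulrCA.
set p := tau%:R / _; set b := block_factor.
transitivity (\sum_(i in Q) (p * (1 - b) * x i ^+ 2 + p * b * (x i * \sum_(k in Q) x k))).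
  apply: eq_bigr => i iQ; rewrite (bigD1 i)//= [X in p * b * (_ * X)](bigD1 i)//=.
  have -> : \sum_s uniform_weight s * ((i \in s)%:R * (i \in s)%:R) = p.
    rewrite /p -(uniform_weight_mem iQ); apply: eq_bigr => s _.
    by case: (i \in s); rewrite ?mulr1 ?mulr0.
  rewrite (mulrDr (x i)) (mulrDr (p * b)) addrA; congr (_ + _); first by ring.
  rewrite !mulr_sumr; apply: eq_bigr => k /andP[kQ ki].
  rewrite uniform_weight_mem2// 1?eq_sym// -/p /b /block_factor.
  have Q2 : (2 <= #|Q|)%N.
    have := subset_leq_card (_ : [set i; k] \subset Q); rewrite cards2 eq_sym ki; apply.
    by apply/fintype.subsetP => j; rewrite !inE => /orP[]/eqP->.
  rewrite (max_idPl _); first by ring.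
  by rewrite lerBrDr -[1]/(1%:R) -natrD ler_nat.
rewrite big_split/= -!mulr_sumr -mulr_suml; ring.
Qed.

Lemma block_factor_ge0 : 0 <= block_factor.
Proof.
apply: divr_ge0; last by rewrite le_max ler01 orbT.
by rewrite subr_ge0 ler1n; case/andP: tau_le.
Qed.

Lemma block_factor_le : block_factor <= tau%:R / #|Q|%:R.
Proof.
rewrite /block_factor; case/andP: (tau_le) => t1 t2.
have Q0 : 0 < #|Q|%:R :> R by rewrite ltr0n (leq_trans t1).
have t1' : 1 <= tau%:R :> R by rewrite ler1n.
have t2' : tau%:R <= #|Q|%:R :> R by rewrite ler_nat.
have [Q2|Q2] := leqP 2 #|Q|.
  have Q2' : 2 <= #|Q|%:R :> R by rewrite ler_nat.
  rewrite (max_idPl _); last lra.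
  rewrite ler_pdivrMr ?subr_gt0; last lra.
  by rewrite mulrAC ler_pdivlMr//; nra.
have Q1 : #|Q| = 1%N by apply/eqP; rewrite eqn_leq -ltnS Q2 (leq_trans t1).
have t11 : tau = 1%N by apply/eqP; rewrite eqn_leq t1 -Q1 t2.
by rewrite Q1 t11 subrr mul0r divr1.
Qed.

End UniformSubset.

(** Cauchy-Schwarz against the constant vector, read off from the nonnegative sum of squared
    deviations; scaling by [#|N|] avoids dividing by a possibly zero cardinality. *)
Lemma sqr_sum_le (R : realFieldType) (I : finType) (N : {set I}) (x : I -> R) :
  (\sum_(i in N) x i) ^+ 2 <= #|N|%:R * \sum_(i in N) x i ^+ 2.
Proof.
set X := \sum_(i in N) x i; set N2 := \sum_(i in N) _ ^+ 2.
have : 0 <= \sum_(i in N) (#|N|%:R * x i - X) ^+ 2 by apply: sumr_ge0 => i _; exact: sqr_ge0.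
have -> : \sum_(i in N) (#|N|%:R * x i - X) ^+ 2 = #|N|%:R * (#|N|%:R * N2 - X ^+ 2).
  transitivity (\sum_(i in N) (#|N|%:R ^+ 2 * x i ^+ 2 - 2 * #|N|%:R * X * x i + X ^+ 2)).
    by apply: eq_bigr => i _; ring.
  rewrite !big_split/= sumrN -!mulr_sumr -/X -/N2 sumr_const -[_ *+ #|N|]mulr_natl; ring.
have [N0|N0] := posnP #|N|.
  by move=> _; rewrite /X (cards0_eq N0) big_set0 expr0n/= mulr_ge0// sumr_ge0// => i _; exact: sqr_ge0.
by rewrite pmulr_rge0 ?ltr0n// subr_ge0.
Qed.

(** * Moments of the union of independent block samplings *)

Section Blocks.
Variables (R : realType) (n c tau : nat) (Part : 'I_c -> {set 'I_n}).
Hypothesis Part_partition : equipartition Part.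
Hypothesis tau_bounds : (1 <= tau <= n %/ c)%N.
Local Notation sampling := {ffun 'I_c -> {set 'I_n}}.
Implicit Types (f : sampling) (x : 'I_n -> R).

Lemma Part_tau l : (1 <= tau <= #|Part l|)%N.
Proof. by rewrite Part_partition.2. Qed.

(* The law of the tuple of the c independent block samplings. *)
Definition block_weight f : R := \prod_l uniform_weight R (Part l) tau (f l).
Definition sampled f : {set 'I_n} := (\bigcup_(l < c) f l)%SET.

Lemma block_weight_ge0 f : 0 <= block_weight f.
Proof.
apply: prodr_ge0 => l _; rewrite /uniform_weight.
by case: ifP => // _; rewrite invr_ge0 ler0n.
Qed.

(** Independence in the form of distributivity of product over sum. Taking [G] equal to 1 except on
    one or two blocks yields the marginal laws below. *)
Lemma sum_block_weight_prod (G : 'I_c -> {set 'I_n} -> R) :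
  \sum_f block_weight f * \prod_l G l (f l) =
  \prod_l \sum_s uniform_weight R (Part l) tau s * G l s.
Proof.
rewrite bigA_distr_bigA; apply: eq_bigr => f _.
by rewrite -big_split.
Qed.

Lemma sum_block_weight : \sum_f block_weight f = 1.
Proof.
have := sum_block_weight_prod (fun _ _ => 1).
under [X in _ = X -> _]eq_bigr => l _ do
  rewrite -mulr_suml mulr1 (sum_uniform_weight R (Part_tau l)).
rewrite big1_eq => H; rewrite -[RHS]H; apply: eq_bigr => f _.
by rewrite mulr1.
Qed.

Lemma sum_block_weight1 l (G : {set 'I_n} -> R) :
  \sum_f block_weight f * G (f l) =
  \sum_s uniform_weight R (Part l) tau s * G s.
Proof.
have := sum_block_weight_prod (fun l' s => if l' == l then G s else 1).
rewrite [in RHS](bigD1 l)//= eqxx [X in _ = _ * X]big1 ?mulr1; last first.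
  move=> l' /negbTE ->; rewrite -mulr_suml mulr1.
  exact: sum_uniform_weight (Part_tau l').
move=> <-; apply: eq_bigr => f _; congr (_ * _).
by rewrite (bigD1 l)//= eqxx big1 ?mulr1// => l' /negbTE ->.
Qed.

Lemma sum_block_weight2 l k (G H : {set 'I_n} -> R) : k != l ->
  \sum_f block_weight f * (G (f l) * H (f k)) =
  (\sum_s uniform_weight R (Part l) tau s * G s) *
  (\sum_s uniform_weight R (Part k) tau s * H s).
Proof.
move=> kl.
have := sum_block_weight_prod (fun l' s => if l' == l then G s else if l' == k then H s else 1).
rewrite [in RHS](bigD1 l)//= [in RHS](bigD1 k)//= !eqxx (negbTE kl) [X in _ = _ * (_ * X)]big1 ?mulr1.
  move=> <-; apply: eq_bigr => f _; congr (_ * _).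
  rewrite (bigD1 l)//= (bigD1 k)//= !eqxx (negbTE kl) big1 ?mulr1//.
  by move=> l' /andP[/negbTE -> /negbTE ->].
move=> l' /andP[/negbTE -> /negbTE ->]; rewrite -mulr_suml mulr1.
exact: sum_uniform_weight (Part_tau l').
Qed.

Lemma mem_Part i l k : i \in Part l -> i \in Part k -> l = k.
Proof. by move=> il ik; have [k' [_ H]] := Part_partition.1 i; rewrite -(H l il) -(H k ik). Qed.

Lemma sum_Part (x : 'I_n -> R) : \sum_i x i = \sum_l \sum_(i in Part l) x i.
Proof.
under [RHS]eq_bigr do rewrite big_mkcond.
rewrite exchange_big; apply: eq_bigr => i _ /=.
have [l [il _]] := Part_partition.1 i.
rewrite (bigD1 l)//= il big1 ?addr0// => k kl; case: ifP => // ik.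
by rewrite (mem_Part il ik) eqxx in kl.
Qed.

(** Only tuples inside their blocks carry mass; for these the union is disjoint, so sums over
    [sampled f] split by block. *)
Lemma block_weight_neq0 f : block_weight f != 0 -> forall l, f l \subset Part l.
Proof.
move=> H l; apply: contraNT H => fl; apply/eqP; rewrite /block_weight (bigD1 l)//=.
by rewrite /uniform_weight (negbTE fl) mul0r.
Qed.

Lemma sum_sampled f x : (forall l, f l \subset Part l) ->
  \sum_(i in sampled f) x i = \sum_l \sum_(i in f l) x i.
Proof.
move=> fP; rewrite big_mkcond sum_Part; apply: eq_bigr => l _.
rewrite [LHS]big_mkcond [RHS]big_mkcond; apply: eq_bigr => i _.
have [il|il] := boolP (i \in Part l); last first.
  by case: ifP => // /(fintype.subsetP (fP l)); rewrite (negbTE il).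
congr (if _ then _ else _); apply/bigcupP/idP => [[k _ ik]|]; last by exists l.
by rewrite (mem_Part il (fintype.subsetP (fP k) _ ik)).
Qed.

Definition marginal : R := tau%:R / (n %/ c)%:R.
Definition pair_factor : R := (tau%:R - 1) / Num.max ((n %/ c)%:R - 1) 1.

Lemma marginal_ge0 : 0 <= marginal.
Proof. by rewrite divr_ge0. Qed.

Lemma sum_block_weight_mem x :
  \sum_f block_weight f * \sum_(i in sampled f) x i = marginal * \sum_i x i.
Proof.
transitivity (\sum_f block_weight f * \sum_l \sum_(i in f l) x i).
  apply: eq_bigr => f _; have [->|/block_weight_neq0 fP] := eqVneq (block_weight f) 0.
    by rewrite !mul0r.
  by rewrite sum_sampled.
under eq_bigr do rewrite mulr_sumr.
rewrite exchange_big sum_Part mulr_sumr; apply: eq_bigr => l _ /=.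
rewrite (sum_block_weight1 l (fun s => \sum_(i in s) x i)).
by rewrite (uniform_weight_sum (Part_tau l)) Part_partition.2.
Qed.

(** Pairs inside one block follow [uniform_weight_sqr]; pairs from different blocks are independent
    and contribute [marginal ^+ 2], hence the last term with the within-block squares removed. *)
Lemma sum_block_weight_sqr x :
  \sum_f block_weight f * (\sum_(i in sampled f) x i) ^+ 2 =
  marginal * ((1 - pair_factor) * (\sum_i x i ^+ 2)
    + pair_factor * (\sum_l (\sum_(i in Part l) x i) ^+ 2)
    + marginal * ((\sum_i x i) ^+ 2 - \sum_l (\sum_(i in Part l) x i) ^+ 2)).
Proof.
pose Z (s : {set 'I_n}) := \sum_(i in s) x i.
transitivity (\sum_l \sum_k \sum_f block_weight f * (Z (f l) * Z (f k))).
  transitivity (\sum_f block_weight f * \sum_l \sum_k Z (f l) * Z (f k)).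
    apply: eq_bigr => f _; have [->|/block_weight_neq0 fP] := eqVneq (block_weight f) 0.
      by rewrite !mul0r.
    rewrite sum_sampled// expr2 mulr_suml; congr (_ * _); apply: eq_bigr => l _.
    by rewrite mulr_sumr.
  under eq_bigr do rewrite mulr_sumr; rewrite exchange_big; apply: eq_bigr => l _ /=.
  by under eq_bigr do rewrite mulr_sumr; rewrite exchange_big.
set p := marginal; set b := pair_factor.
transitivity (\sum_l (p * ((1 - b) * (\sum_(i in Part l) x i ^+ 2) + b * Z (Part l) ^+ 2)
   + p ^+ 2 * (Z (Part l) * (\sum_k Z (Part k)) - Z (Part l) ^+ 2))).
  apply: eq_bigr => l _; rewrite (bigD1 l)//=; congr (_ + _).
    rewrite (sum_block_weight1 l (fun s => Z s * Z s)).
    have := uniform_weight_sqr (Part_tau l) x.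
    rewrite /block_factor Part_partition.2 -/marginal -/pair_factor => <-.
    by apply: eq_bigr => s _; rewrite expr2.
  have -> : Z (Part l) * (\sum_k Z (Part k)) - Z (Part l) ^+ 2 =
      Z (Part l) * \sum_(k | k != l) Z (Part k) by rewrite (bigD1 l)//=; ring.
  rewrite !mulr_sumr; apply: eq_bigr => k kl.
  rewrite sum_block_weight2// !(uniform_weight_sum (Part_tau _)) !Part_partition.2.
  by rewrite -/marginal -/p -!/(Z _); ring.
rewrite big_split/= -!mulr_sumr big_split/= sumrB -!mulr_sumr -mulr_suml.
by rewrite -!sum_Part expr2 expr2; ring.
Qed.

Lemma pair_factor_ge0 (l : 'I_c) : 0 <= pair_factor.
Proof. by have := block_factor_ge0 R (Part_tau l); rewrite /block_factor Part_partition.2. Qed.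

Lemma pair_factor_le (l : 'I_c) : pair_factor <= marginal.
Proof. by have := block_factor_le R (Part_tau l); rewrite /block_factor Part_partition.2. Qed.

(* For [x i := (A i *m h i) j 0], [#|N|] and [#|L|] are omega_j and omega'_j. *)
Lemma sum_block_weight_sqr_le x (N : {set 'I_n}) (L : {set 'I_c}) : L != finset.set0 ->
  (forall i, i \notin N -> x i = 0) ->
  (forall l i, l \notin L -> i \in Part l -> x i = 0) ->
  \sum_f block_weight f * (\sum_(i in sampled f) x i) ^+ 2 <=
  marginal * ((1 + pair_factor * (#|N|%:R - 1)
    + (marginal - pair_factor) * ((#|L|%:R - 1) / #|L|%:R) * #|N|%:R) * \sum_i x i ^+ 2).
Proof.
move=> /set0Pn[l0 l0L] xN xL; rewrite sum_block_weight_sqr.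
apply: ler_wpM2l; first exact: marginal_ge0.
have L1 : 1 <= #|L|%:R :> R by rewrite ler1n; apply/card_gt0P; exists l0.
have p0 := pair_factor_ge0 l0; have pm := pair_factor_le l0.
set p := marginal in pm *; set b := pair_factor in p0 pm *.
have N1 : \sum_i x i = \sum_(i in N) x i.
  by rewrite [RHS]big_mkcond; apply: eq_bigr => i _; case: ifPn => // /xN.
have N2 : \sum_i x i ^+ 2 = \sum_(i in N) x i ^+ 2.
  rewrite [RHS]big_mkcond; apply: eq_bigr => i _; case: ifPn => // /xN ->.
  by rewrite expr0n.
have zL l : l \notin L -> \sum_(i in Part l) x i = 0.
  by move=> lL; apply: big1 => i; exact: xL.
have L2 : \sum_i x i = \sum_(l in L) \sum_(i in Part l) x i.
  by rewrite sum_Part [RHS]big_mkcond; apply: eq_bigr => l _; case: ifPn => // /zL.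
have L3 : \sum_l (\sum_(i in Part l) x i) ^+ 2 = \sum_(l in L) (\sum_(i in Part l) x i) ^+ 2.
  rewrite [RHS]big_mkcond; apply: eq_bigr => l _; case: ifPn => // /zL ->.
  by rewrite expr0n.
have := sqr_sum_le N x; rewrite -N1 -N2.
have := sqr_sum_le L (fun l => \sum_(i in Part l) x i); rewrite -L2 -L3.
set X := \sum_i x i; set X2 := \sum_i x i ^+ 2; set Y := \sum_l _.
set r := #|L|%:R in L1 *; set o := #|N|%:R => h1 h2.
have r0 : 0 < r by rewrite (lt_le_trans ltr01).
(* Only [r] blocks contribute, so [X ^+ 2 <= r * Y], which bounds the cross-block part by the
   fraction [(r - 1) / r] of [X ^+ 2]; the bound over the [o] nonzero columns then finishes. *)
have h3 : X ^+ 2 - Y <= (r - 1) / r * (o * X2).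
  apply: (@le_trans _ _ ((r - 1) / r * X ^+ 2)).
    rewrite mulrAC ler_pdivlMr//; nra.
  by rewrite ler_wpM2l// divr_ge0 ?subr_ge0// ltW.
have h4 : (p - b) * (X ^+ 2 - Y) <= (p - b) * ((r - 1) / r * (o * X2)).
  by rewrite ler_wpM2l// subr_ge0.
have h5 : b * X ^+ 2 <= b * (o * X2) by rewrite ler_wpM2l.
move: h4; set q := (r - 1) / r => h4.
lra.
Qed.

End Blocks.

Local Open Scope classical_set_scope.
Local Open Scope ring_scope.

(** * Smooth and convex functions on Euclidean space *)

Section Euclidean.
Variables (R : realType) (k : nat).
Implicit Types (x y z : 'cV[R]_k) (a : R).

Lemma dotvC x y : dotv x y = dotv y x.
Proof. by apply: eq_bigr => i _; rewrite mulrC. Qed.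

Lemma dotvDl x y z : dotv (x + y) z = dotv x z + dotv y z.
Proof. by rewrite -big_split; apply: eq_bigr => i _; rewrite mxE mulrDl. Qed.

Lemma dotvDr x y z : dotv z (x + y) = dotv z x + dotv z y.
Proof. by rewrite !(dotvC z) dotvDl. Qed.

Lemma dotvZl a x y : dotv (a *: x) y = a * dotv x y.
Proof. by rewrite mulr_sumr; apply: eq_bigr => i _; rewrite mxE mulrA. Qed.

Lemma dotvZr a x y : dotv x (a *: y) = a * dotv x y.
Proof. by rewrite !(dotvC x) dotvZl. Qed.

Lemma dotvNl x y : dotv (- x) y = - dotv x y.
Proof. by rewrite -scaleN1r dotvZl mulN1r. Qed.

Lemma dotvNr x y : dotv x (- y) = - dotv x y.
Proof. by rewrite !(dotvC x) dotvNl. Qed.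

Lemma dotvBl x y z : dotv (x - y) z = dotv x z - dotv y z.
Proof. by rewrite dotvDl dotvNl. Qed.

Lemma dotvBr x y z : dotv z (x - y) = dotv z x - dotv z y.
Proof. by rewrite dotvDr dotvNr. Qed.

Lemma dotv0l x : dotv 0 x = 0.
Proof. by rewrite -(scale0r 0) dotvZl mul0r. Qed.

Lemma dotv0r x : dotv x 0 = 0.
Proof. by rewrite dotvC dotv0l. Qed.

Definition dotvE :=
  (dotvDl, dotvDr, dotvNl, dotvNr, dotvZl, dotvZr, dotv0l, dotv0r).

Lemma dotv_sumr (I : Type) (r : seq I) (Q : pred I) x (F : I -> 'cV[R]_k) :
  dotv x (\sum_(i <- r | Q i) F i) = \sum_(i <- r | Q i) dotv x (F i).
Proof.
by apply: (big_morph _ (fun y z => dotvDr y z x) (dotv0r x)).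
Qed.

Lemma dotv_ge0 x : 0 <= dotv x x.
Proof. by apply: sumr_ge0 => i _; rewrite -expr2 sqr_ge0. Qed.

Lemma dotv_eq0 x : (dotv x x == 0) = (x == 0).
Proof.
apply/eqP/eqP => [x0|->]; last by rewrite dotv0l.
apply/matrixP => i j; rewrite (ord1 j) mxE.
have nn (l : 'I_k) : true -> 0 <= x l 0 * x l 0 by rewrite -expr2 sqr_ge0.
have := psumr_eq0P nn x0 isT; move=> /(_ i)/eqP.
by rewrite -expr2 sqrf_eq0 => /eqP.
Qed.

Lemma enorm_sqr x : enorm x ^+ 2 = dotv x x.
Proof. by rewrite sqr_sqrtr// dotv_ge0. Qed.

Lemma enorm_ge0 x : 0 <= enorm x.
Proof. exact: sqrtr_ge0. Qed.

Lemma cauchy_schwarz x y : dotv x y <= enorm x * enorm y.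
Proof.
have [xy0|xy0] := leP (dotv x y) 0.
  by rewrite (le_trans xy0)// mulr_ge0// enorm_ge0.
rewrite -ler_sqr ?nnegrE ?mulr_ge0 ?enorm_ge0 ?(ltW xy0)// exprMn !enorm_sqr.
have := dotv_ge0 (dotv y y *: x - dotv x y *: y).
rewrite !dotvE (dotvC y x); set a := dotv x x; set b := dotv y y.
set e := dotv x y; move=> h.
have [b0|b0] := ltP 0 b; first by rewrite -(ler_pM2l b0); lra.
have {}b0 : b = 0 by apply/eqP; rewrite eq_le b0 dotv_ge0.
move/eqP: b0; rewrite dotv_eq0 => /eqP y0.
by move: xy0; rewrite -/e /e y0 dotv0r ltxx.
Qed.

Lemma abs_coord_le_enorm x i : `|x i 0| <= enorm x.
Proof.
rewrite -ler_sqr ?nnegrE ?enorm_ge0// enorm_sqr real_normK ?num_real//.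
rewrite /dotv (bigD1 i)//= -expr2 lerDl.
by apply: sumr_ge0 => j _; rewrite -expr2 sqr_ge0.
Qed.

Lemma col_sum_delta x : x = \sum_(i < k) x i 0 *: delta_mx i 0.
Proof.
apply/matrixP => i j; rewrite (ord1 j) summxE (bigD1 i)//= big1 ?addr0.
  by rewrite !mxE !eqxx mulr1.
by move=> l; rewrite !mxE eq_sym => /negbTE ->; rewrite mulr0.
Qed.

Lemma dotv_delta x i : dotv x (delta_mx i 0) = x i 0.
Proof.
rewrite /dotv (bigD1 i)//= big1 ?addr0; first by rewrite !mxE !eqxx mulr1.
by move=> l; rewrite !mxE => /negbTE ->; rewrite mulr0.
Qed.

End Euclidean.

Lemma dotv_mulmx (R : realType) (k l : nat) (M : 'M[R]_(k, l)) x y :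
  dotv x (M *m y) = dotv (M^T *m x) y.
Proof.
have E (r : nat) (u w : 'cV[R]_r) : dotv u w = (u^T *m w) 0 0.
  by rewrite mxE; apply: eq_bigr => i _; rewrite mxE.
by rewrite !E trmx_mul trmxK mulmxA.
Qed.

Section Smooth.
Variables (R : realType) (k : nat).
Implicit Types (x y z v : 'cV[R]_k) (f : 'cV[R]_k -> R).

Lemma derive_gradient f x v :
  differentiable (f : 'cV[R]_k -> R^o) x ->
  derive (f : 'cV[R]_k -> R^o) x v = dotv (gradient f x) v.
Proof.
move=> df; rewrite deriveE// {1}(col_sum_delta v) linear_sum.
by apply: eq_bigr => i _; rewrite linearZ /= mxE deriveE// mulrC.
Qed.

Lemma is_derive_line f x v (t : R) :
  differentiable (f : 'cV[R]_k -> R^o) (x + t *: v) ->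
  is_derive t (1 : R) (fun t => f (x + t *: v) : R^o)
    (dotv (gradient f (x + t *: v)) v).
Proof.
move=> df; have E : (fun s : R => s^-1 *: ((f (x + (s *: (1 : R) + t) *: v) : R^o)
    - f (x + t *: v))) = (fun s => s^-1 *: ((f (s *: v + (x + t *: v)) : R^o)
    - f (x + t *: v))).
  apply/funext => s; congr (_ *: (f _ - _)).
  by rewrite [_ *: 1]mulr1 scalerDl addrCA.
have dv : derivable (f : 'cV[R]_k -> R^o) (x + t *: v) v.
  exact: diff_derivable.
apply: DeriveDef.
  by rewrite /derivable /= [X in cvg (X @ _)]E.
by rewrite -derive_gradient// /derive /= [X in lim (X @ _)]E.
Qed.

Lemma convexP f : convex f -> forall x y (t : R), 0 <= t <= 1 ->
  f (t *: x + (1 - t) *: y) <= t * f x + (1 - t) * f y.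
Proof.
move=> cf x y t t01.
have := cf (Itv01 (andP t01).1 (andP t01).2) x y (mem_setT _) (mem_setT _).
by [].
Qed.

Lemma convex_gradient f x : differentiable (f : 'cV[R]_k -> R^o) x ->
  convex f -> subgradient f x (gradient f x).
Proof.
move=> df cf y; rewrite -lerBrDl.
pose v := y - x.
have dv : derivable (f : 'cV[R]_k -> R^o) x v by exact: diff_derivable.
rewrite -/v -derive_gradient// /derive.
(* The two-sided derivative exists, so it can be computed along [h > 0], where convexity bounds each
   difference quotient by [f y - f x]. *)
rewrite (_ : lim _ = lim ((fun h : R => h^-1 *: ((f (h *: v + x) : R^o) - f x)) @ 0^'+)).
  apply: limr_le.
    by apply: cvgP; apply: cvg_dnbhs_at_right; exact: dv.
  near=> h.
  have h0 : 0 < h by near: h; exact: nbhs_right_gt.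
  have h1 : h <= 1 by near: h; exact: nbhs_right_le.
  rewrite [_ *: _]mulrC ler_pdivrMr// (_ : h *: v + x = h *: y + (1 - h) *: x).
    have h01 : 0 <= h <= 1 by rewrite ltW.
    have := convexP cf y x h01; lra.
  by rewrite /v scalerBr scalerBl scale1r addrAC addrA.
exact: (@cvg_at_rightE _ R^o (fun h : R => h^-1 *: ((f (h *: v + x) : R^o) - f x)) 0 dv).
Unshelve. all: by end_near. Qed.

(** The difference [h] between [f] on the segment and the claimed quadratic has nonpositive
    derivative on the unit interval, by Cauchy-Schwarz and the Lipschitz bound; hence
    [h 1 <= h 0]. *)
Lemma descent_lemma L f x v : lipschitz_gradient L f -> 
  f (x + v) <= f x + dotv (gradient f x) v + L / 2 * dotv v v.
Proof.
move=> [df lf].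
pose h (t : R) : R^o := f (x + t *: v) - (t * dotv (gradient f x) v
   + t ^+ 2 * (L / 2 * dotv v v)).
pose h' (t : R) := dotv (gradient f (x + t *: v)) v -
  (dotv (gradient f x) v + t *+ 2 * (L / 2 * dotv v v)).
have dh (t : R) : is_derive t (1 : R) h (h' t).
  have d1 := @is_derive_line f x v t (df _).
  rewrite /h /h'; apply: is_deriveB.
  apply: is_derive_eq; rewrite !scaler0 !add0r /GRing.scale /= !mulr1.
  by rewrite mulr2n; ring.
have := @ler0_derive1_le_cc R h 0 1.
have h01 : h 1 <= h 0 -> f (x + v) <= f x + dotv (gradient f x) v + L / 2 * dotv v v.
  rewrite /h scale1r scale0r addr0 expr0n expr1n !mul0r !mul1r addr0 subr0.
  by rewrite lerBlDr addrA.
move=> D; apply: h01; apply: D; rewrite ?in_itv/= ?lexx ?ler01//.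
- move=> t; rewrite in_itv/= => /andP[t0 t1].
  rewrite derive1E (@derive_val _ _ _ _ _ _ _ (dh t)) /h' subr_le0 -lerBlDl.
  rewrite -dotvBl (le_trans (cauchy_schwarz _ _))//.
  have := lf (x + t *: v) x; rewrite addrAC subrr add0r => lf'.
  rewrite (le_trans (ler_wpM2r (enorm_ge0 _) lf'))//.
  rewrite -!enorm_sqr.
  have -> : enorm (t *: v) = t * enorm v.
    by rewrite /enorm dotvZl dotvZr mulrA -expr2 sqrtrM ?sqr_ge0// sqrtr_sqr ger0_norm// ltW.
  by rewrite mulr2n; nra.
- by apply: derivable_within_continuous => t _; have [] := dh t.
Qed.

End Smooth.

(** * Fenchel conjugates *)

Section Conjugate.
Variables (R : realType) (k : nat).
Implicit Types (x y z v u s : 'cV[R]_k) (f : 'cV[R]_k -> R).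

Lemma conjugate_ge f u s : ((dotv s u - f s)%:E <= conjugate f u)%E.
Proof. by apply: ereal_sup_ubound; exists s. Qed.

Lemma conjugate_le f u (r : R) :
  (forall s, dotv s u - f s <= r) -> (conjugate f u <= r%:E)%E.
Proof. by move=> h; apply: ge_ereal_sup => _ [s _ <-]; rewrite lee_fin. Qed.

Lemma conjugate_gtNy f u : (-oo < conjugate f u)%E.
Proof. by rewrite (lt_le_trans _ (conjugate_ge f u 0))// ltNyr. Qed.

(** The equality case of Fenchel-Young: a subgradient inequality says exactly that [s] attains the
    supremum. *)
Lemma conjugate_subgradient f u s :
  subgradient f s u -> conjugate f u = (dotv s u - f s)%:E.
Proof.
move=> us; apply/eqP; rewrite eq_le conjugate_ge andbT.
apply: conjugate_le => y; have := us y; rewrite dotvBr !(dotvC u); lra.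
Qed.

(** For each candidate [z], the suprema at [x] and [y] are tested at [z + gamma (1 - q) e] and
    [z - gamma q e], with [e = x - y]. Averaging with weights [q] and [1 - q] cancels the gradient
    terms of the descent lemma; the linear gain [gamma q (1 - q) |e|^2] exceeds the quadratic cost
    by half of itself. *)
Lemma conjugate_strongly_convex (gamma : R) f x y (a b q : R) :
  0 < gamma -> lipschitz_gradient gamma^-1 f ->
  conjugate f x = a%:E -> conjugate f y = b%:E -> 0 <= q <= 1 ->
  (conjugate f (q *: x + (1 - q) *: y) <=
   (q * a + (1 - q) * b - gamma / 2 * (q * (1 - q)) * dotv (x - y) (x - y))%:E)%E.
Proof.
move=> g0 fs fx fy /andP[q0 q1]; apply: conjugate_le => z.
have [e eE] : exists e, e = x - y by eexists.
have := conjugate_ge f x (z + (gamma * (1 - q)) *: e).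
have := conjugate_ge f y (z + (- (gamma * q)) *: e).
rewrite fx fy !lee_fin => hb ha.
have := descent_lemma z ((gamma * (1 - q)) *: e) fs.
have := descent_lemma z ((- (gamma * q)) *: e) fs.
rewrite !dotvZl !dotvZr => db da.
have ex : dotv e x - dotv e y = dotv e e by rewrite -dotvBr -eE.
have g1 : gamma^-1 / 2 * (gamma * (1 - q) * (gamma * (1 - q) * dotv e e)) =
   gamma / 2 * (1 - q) ^+ 2 * dotv e e by field; rewrite gt_eqF.
have g2 : gamma^-1 / 2 * (- (gamma * q) * (- (gamma * q) * dotv e e)) =
   gamma / 2 * q ^+ 2 * dotv e e by field; rewrite gt_eqF.
rewrite g1 in da; rewrite g2 in db.
rewrite -eE; move: ha hb; rewrite !dotvDl !dotvZl !dotvDr !dotvZr => ha hb.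
have {}ha : q * (dotv z x + gamma * (1 - q) * dotv e x -
  (f z + gamma * (1 - q) * dotv (gradient f z) e + gamma / 2 * (1 - q) ^+ 2 * dotv e e))
  <= q * a by apply: ler_wpM2l => //; lra.
have {}hb : (1 - q) * (dotv z y + - (gamma * q) * dotv e y -
  (f z + - (gamma * q) * dotv (gradient f z) e + gamma / 2 * q ^+ 2 * dotv e e))
  <= (1 - q) * b by apply: ler_wpM2l => //; lra.
move: ha hb; rewrite (_ : dotv e x = dotv e e + dotv e y); last by rewrite -ex subrK.
move=> ha hb; rewrite lerBrDr (le_trans _ (lerD ha hb))// le_eqVlt; apply/orP; left; apply/eqP.
by field.
Qed.

End Conjugate.

(** * Continuity of finite convex functions and minima on cubes *)

Section ConvexContinuity.
Variables (R : realType) (k : nat).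
Implicit Types (x y z v u s h : 'cV[R]_k) (f : 'cV[R]_k -> R).

Lemma convex_average f : convex f -> forall (n : nat) (x : 'I_n.+1 -> 'cV[R]_k),
  f (n.+1%:R^-1 *: \sum_i x i) <= n.+1%:R^-1 * \sum_i f (x i).
Proof.
move=> cf; elim=> [|n IH] x.
  by rewrite !big_ord1 invr1 scale1r mul1r.
rewrite !(big_ord_recr n.+1)/=.
set S := \sum_(i < n.+1) x _; set T := \sum_(i < n.+1) f _.
have n1 : n.+1%:R != 0 :> R by rewrite pnatr_eq0.
have n2 : n.+2%:R != 0 :> R by rewrite pnatr_eq0.
have e2 : n.+2%:R = n.+1%:R + 1 :> R by rewrite natr1.
set t : R := n.+2%:R^-1.
have t01 : 0 <= t <= 1.
  by rewrite invr_ge0 ler0n/= invf_le1 ?ltr0n// ler1n.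
have tE : (1 - t) * n.+1%:R^-1 = t.
  by rewrite /t; move: n2 n1; rewrite e2; move: (n.+1%:R : R) => r r1 r0; field; rewrite r1.
rewrite (_ : t *: (S + _) = t *: x ord_max + (1 - t) *: (n.+1%:R^-1 *: S)).
  have := convexP cf (x ord_max) (n.+1%:R^-1 *: S) t01.
  have := IH (fun i => x (widen_ord (leqnSn n.+1) i)); rewrite -/S -/T => IH' cf'.
  rewrite (le_trans cf')// mulrDr addrC lerD2r -{2}tE -mulrA ler_wpM2l//.
  by rewrite subr_ge0; case/andP: t01.
by rewrite scalerA tE scalerDr addrC.
Qed.

(** The point [x + t *: v] lies between [x] and [x + v] or between [x] and [x - v]; adding both
    increments covers the two signs of [t] at once. *)
Lemma convex_slope f x v (t : R) : convex f -> `|t| <= 1 ->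
  f (x + t *: v) - f x <= `|t| * (`|f (x + v) - f x| + `|f (x - v) - f x|).
Proof.
move=> cf t1; have [t0|/ltW t0] := leP 0 t.
  have t01 : 0 <= t <= 1 by rewrite t0 (le_trans (ler_norm _)).
  rewrite (_ : x + t *: v = t *: (x + v) + (1 - t) *: x); last first.
    by apply/matrixP => i j; rewrite !mxE; ring.
  have := convexP cf (x + v) x t01; rewrite ger0_norm//.
  have := ler_norm (f (x + v) - f x); have := normr_ge0 (f (x - v) - f x); nra.
have t01 : 0 <= - t <= 1 by rewrite oppr_ge0 t0 (le_trans _ t1)// -normrN ler_norm.
rewrite (_ : x + t *: v = (- t) *: (x - v) + (1 - - t) *: x); last first.
  by apply/matrixP => i j; rewrite !mxE; ring.
have := convexP cf (x - v) x t01; rewrite ler0_norm//.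
have := ler_norm (f (x - v) - f x); have := normr_ge0 (f (x + v) - f x); nra.
Qed.

End ConvexContinuity.

Section Cube.
Variables (R : realType) (k : nat).
Implicit Types (x y z v u s h : 'cV[R]_k) (f : 'cV[R]_k -> R).

Lemma convex_locally_lipschitz f x : convex f -> exists2 C : R, 0 <= C &
  forall (e : R) h, 0 <= e <= 1 -> (forall i, `|h i 0| <= e) ->
    `|f (x + h) - f x| <= C * e.
Proof.
move=> cf.
(* A bound from above suffices: [x] is the midpoint of [x + h] and [x - h], so the upper bound at
   [- h] gives the lower bound at [h]. *)
suff [C C0 H] : exists2 C : R, 0 <= C & forall (e : R) h, 0 <= e <= 1 ->
    (forall i, `|h i 0| <= e) -> f (x + h) - f x <= C * e.
  exists C => // e h e1 he; rewrite ler_norml // (H _ _ e1 he) andbT.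
  have {}he i : `|(- h) i 0| <= e by rewrite mxE normrN.
  have := H e (- h) e1 he.
  have /(convexP cf (x + h) (x - h)) : 0 <= (2^-1 : R) <= 1 by lra.
  rewrite (_ : _ *: _ + _ = x); first lra.
  apply/matrixP => i j; by rewrite !mxE; field.
case: k f x cf => [|n] f x cf.
  exists 0 => // e h _ _; rewrite mul0r (_ : h = 0) ?addr0 ?subrr//.
  by apply/matrixP => -[].
(* The factor [n.+1] makes [x + h] the plain average of the points [x + h i 0 *: v i], each moved
   along one axis only, so that [convex_average] and [convex_slope] apply. *)
pose v i : 'cV[R]_n.+1 := n.+1%:R *: delta_mx i 0.
pose M i := `|f (x + v i) - f x| + `|f (x - v i) - f x|.
exists (\sum_i M i); first by apply: sumr_ge0 => i _; rewrite addr_ge0.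
move=> e h /andP[e0 e1] he.
have n1 : n.+1%:R != 0 :> R by rewrite pnatr_eq0.
have -> : x + h = n.+1%:R^-1 *: \sum_i (x + h i 0 *: v i).
  rewrite big_split/= sumr_const card_ord scalerDr -[x *+ _]scaler_nat scalerA mulVf// scale1r.
  congr (_ + _); rewrite {1}(col_sum_delta h) scaler_sumr; apply: eq_bigr => i _.
  by rewrite /v [RHS]scalerA scalerA; congr (_ *: _); rewrite mulrAC mulVf// mul1r.
rewrite (@le_trans _ _ (n.+1%:R^-1 * \sum_i f (x + h i 0 *: v i) - f x))//.
  by rewrite lerD2r; exact: (convex_average cf (fun i => x + h i 0 *: v i)).
have -> : f x = n.+1%:R^-1 * \sum_(i < n.+1) f x.
  by rewrite sumr_const card_ord -[X in _ * X]mulr_natl mulrA mulVf// mul1r.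
rewrite -mulrBr -sumrB ler_pdivrMl ?ltr0n// mulrC -mulrA mulr_suml.
apply: ler_sum => i _.
have h1 : `|h i 0| <= 1 by rewrite (le_trans (he i)).
apply: le_trans (convex_slope x (v i) cf h1) _; rewrite -/(M i) mulrC.
by rewrite ler_wpM2r ?addr_ge0// (le_trans (he i))// ler_peMr// ler1n.
Qed.

Lemma convex_continuous f : convex f -> continuous (f : 'cV[R]_k -> R^o).
Proof.
move=> cf x; have [C C0 H] := convex_locally_lipschitz x cf.
apply/(@cvgrPdist_le _ R^o _ (nbhs x)) => e e0.
pose d : R := Num.min 1 (e / (C + 1)).
have d0 : 0 < d by rewrite lt_min ltr01 divr_gt0// ltr_wpDl.
near=> y.
have yd : ball x d y by near: y; exact: nbhsx_ballx.
rewrite distrC; have -> : f y = f (x + (y - x)) by rewrite addrC subrK.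
rewrite (le_trans (H d _ _ _))//.
- by rewrite (ltW d0)/= ge_min lexx.
- by move=> i; rewrite !mxE distrC ltW//; apply: yd.2.
- rewrite (@le_trans _ _ (C * (e / (C + 1))))// ?ler_wpM2l// ?ge_min ?lexx ?orbT//.
  by rewrite mulrCA ler_piMr ?(ltW e0)// ler_pdivrMr ?ltr_wpDl// mul1r lerDl.
Unshelve. all: by end_near. Qed.

Lemma compact_cube (r : R) : compact [set x : 'cV[R]_k | forall i, `|x i 0| <= r].
Proof.
have c : compact [set x : 'rV[R]_k | forall i, `[- r, r]%classic (x 0 i)].
  by apply: (@rV_compact _ _ (fun=> `[- r, r]%classic)) => i; exact: segment_compact.
rewrite (_ : [set _ | _] = trmx @` [set x : 'rV[R]_k | forall i, `[- r, r]%classic (x 0 i)]).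
  apply: continuous_compact => //; apply: continuous_subspaceT => x.
  apply/(@cvg_ballP _ _ _ (nbhs x)) => e e0; near=> y; split=> // i j; rewrite !mxE.
  have xy : ball x e y by near: y; exact: nbhsx_ballx.
  exact: xy.2.
apply/seteqP; split => [x xr|_ [x xr <-] i] /=.
  exists x^T; rewrite ?trmxK// => i; rewrite /= in_itv/= mxE.
  by have := xr i; rewrite ler_norml.
by have := xr i; rewrite /= in_itv/= mxE ler_norml.
Unshelve. all: by end_near. Qed.

Lemma min_on_cube f (r : R) : continuous (f : 'cV[R]_k -> R^o) -> 0 <= r ->
  exists2 s : 'cV[R]_k, (forall i, `|s i 0| <= r) &
    forall y, (forall i, `|y i 0| <= r) -> f s <= f y.
Proof.
move=> cf r0.
have [||s sr H] := compact_EVT_min _ (@compact_cube r) (f := f).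
- by exists 0 => i /=; rewrite mxE normr0.
- exact: continuous_subspaceT.
exists s; first by move: sr; rewrite inE.
by move=> y yr; apply: H; rewrite inE.
Qed.

Lemma continuous_dotv (f g : 'cV[R]_k -> 'cV[R]_k) :
  (forall i, continuous (fun x => f x i 0 : R^o)) ->
  (forall i, continuous (fun x => g x i 0 : R^o)) ->
  continuous (fun x => dotv (f x) (g x) : R^o).
Proof.
move=> cf cg; apply: (@continuous_big R^o _ +%R 0).
  exact: add_continuous.
by move=> i _ x; have := cvgM (cf i x) (cg i x); apply; exact: nbhs_filter.
Qed.

End Cube.

(** * The conjugate of a strongly convex function and its gradient *)

Section StronglyConvex.
Variables (R : realType) (k : nat).
Implicit Types (x y z v u s h w : 'cV[R]_k) (f g : 'cV[R]_k -> R).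

Lemma continuous_coord i : continuous (fun x : 'cV[R]_k => x i 0 : R^o).
Proof. exact: coord_continuous. Qed.

(* For [K] large, the minimiser [s] of [f + K |.|^2] on the unit cube is interior,
   and [- 2 K s] is a subgradient of [f] at [s]. *)
Lemma convex_subgradient_exists f : convex f -> exists s z, subgradient f s z.
Proof.
move=> cf; have cont := convex_continuous cf.
have [s0 s0c s0min] := min_on_cube cont ler01.
(* Comparing with 0, a minimiser [s] has [K |s|^2 <= f 0 - f s0 = (K - 1) / 4], so [|s| <= 1/2] and
   the faces of the cube are out of reach. *)
pose K := 4 * (f 0 - f s0) + 1.
have c0 : forall i, `|(0 : 'cV[R]_k) i 0| <= 1 by move=> i; rewrite mxE normr0.
have K0 : 1 <= K by rewrite /K; have := s0min 0 c0; lra.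
have ch : continuous (fun x => f x + K * dotv x x : R^o).
  move=> x; apply: (@cvgD _ R^o); [exact: nbhs_filter|exact: cont|].
  apply: cvgM; [exact: nbhs_filter|by apply: cvg_cst; exact: nbhs_filter|].
  by apply: (@continuous_dotv _ _ id id); exact: continuous_coord.
have [s sc smin] := min_on_cube ch ler01.
have s4 : enorm s <= 2^-1.
  rewrite -ler_sqr ?nnegrE ?enorm_ge0 ?invr_ge0// enorm_sqr.
  have := smin 0 c0; have := s0min s sc; rewrite dotv0l mulr0 addr0 => h1 h2.
  have h3 : K * dotv s s <= K * (2^-1 ^+ 2) by rewrite /K in h2 *; lra.
  by rewrite ler_pM2l in h3 => //; lra.
exists s, (- (2 * K) *: s) => y.
have [v vE] : exists v, v = y - s by eexists.
rewrite -vE dotvZl.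
(* Minimality at [s + t *: v] and convexity of [f], divided by [t], give the subgradient inequality
   up to [K * t * dotv v v], which is made arbitrarily small. *)
suff small t : 0 < t <= 1 -> t * enorm v <= 2^-1 ->
    f s - 2 * K * dotv s v - K * t * dotv v v <= f y.
  apply/ler_addgt0Pl => e e0.
  pose t := Num.min 1 (Num.min (2^-1 / (enorm v + 1)) (e / (K * dotv v v + 1))).
  have v1 : 0 < enorm v + 1 by rewrite ltr_wpDl ?enorm_ge0.
  have v2 : 0 < K * dotv v v + 1.
    by rewrite ltr_wpDl// mulr_ge0 ?dotv_ge0// (le_trans ler01).
  have t0 : 0 < t by rewrite !lt_min ltr01 !divr_gt0.
  have t1 : t <= 1 by rewrite ge_min lexx.
  have t2 : t * (enorm v + 1) <= 2^-1.
    by rewrite -ler_pdivlMr// !ge_min lexx ?orbT.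
  have t3 : t * (K * dotv v v + 1) <= e.
    by rewrite -ler_pdivlMr// !ge_min lexx ?orbT.
  have : 0 < t <= 1 by rewrite t0.
  by move/small; rewrite mulrDr mulr1 in t2; rewrite mulrDr mulr1 mulrCA in t3; lra.
move=> /andP[t0 t1] tv.
have ct i : `|(s + t *: v) i 0| <= 1.
  rewrite !mxE (le_trans (ler_normD _ _))//.
  rewrite (_ : 1 = 2^-1 + 2^-1 :> R); last lra.
  apply: lerD; first by rewrite (le_trans (abs_coord_le_enorm _ _)).
  rewrite normrM gtr0_norm// (le_trans _ tv)// ler_pM2l//.
  exact: abs_coord_le_enorm.
have := smin _ ct; have t01 : 0 <= t <= 1 by rewrite ltW.
have := convexP cf y s t01.
rewrite (_ : t *: y + _ = s + t *: v); last first.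
  by apply/matrixP => i j; rewrite vE !mxE; ring.
rewrite !dotvE (dotvC v s) => h1 h2.
have : t * (f s - 2 * K * dotv s v - K * t * dotv v v) <= t * f y by lra.
by rewrite ler_pM2l.
Qed.

(* [u] is a subgradient at the maximiser of [w |-> <u, w> - g w], which exists
   because one subgradient already forces quadratic growth. *)
Lemma strongly_convex_argmax g u : strongly_convex1 g ->
  exists s, subgradient g s u.
Proof.
move=> [cg sg]; have [s0 [z sz]] := convex_subgradient_exists cg.
(* Outside this cube [|y - s0| >= 2 |u - z|], so the growth [|y - s0|^2 / 2] beats [<u - z, y - s0>]
   and [y] does no better than [s0], which lies inside. *)
pose r := enorm s0 + 2 * enorm (u - z).
have ch : continuous (fun x => g x + - dotv u x : R^o).
  move=> x; apply: (@cvgD _ R^o); [exact: nbhs_filter|exact: (convex_continuous cg)|].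
  apply: (@cvgN _ R^o); [exact: nbhs_filter|]; apply: (@continuous_dotv _ _ (fun=> u) id) => i.
    by move=> y; apply: cvg_cst; exact: nbhs_filter.
  exact: continuous_coord.
have r0 : 0 <= r by rewrite addr_ge0 ?mulr_ge0 ?enorm_ge0.
have [s sc smin] := min_on_cube ch r0.
exists s => y; rewrite dotvBr.
suff : g s - dotv u s <= g y - dotv u y by lra.
have [/forallP yc|] := boolP [forall i, `|y i 0| <= r]; first exact: smin.
rewrite negb_forall => /existsP[i]; rewrite -ltNge => yi.
have s0c j : `|s0 j 0| <= r.
  by rewrite (le_trans (abs_coord_le_enorm _ _))// lerDl mulr_ge0 ?enorm_ge0.
apply: le_trans (smin _ s0c) _.
have := sg y s0 z sz; rewrite enorm_sqr.
have far : 2 * enorm (u - z) <= enorm (y - s0).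
  have := abs_coord_le_enorm (y - s0) i; rewrite !mxE.
  have := lerB_dist (y i 0) (s0 i 0); have := abs_coord_le_enorm s0 i.
  by rewrite /r in yi; lra.
have := cauchy_schwarz (u - z) (y - s0).
rewrite -enorm_sqr dotvBl !dotvBr => cs.
have := enorm_ge0 (u - z); have := enorm_ge0 (y - s0).
by move: far cs; set a := enorm (u - z); set b := enorm (y - s0); nra.
Qed.

(** With [w = s + e], strong convexity leaves [<e, h> - |e|^2 / 2], which is at most [|h|^2 / 2] by
    completing the square. *)
Lemma conjugate_smooth g s u h : strongly_convex1 g -> subgradient g s u ->
  (conjugate g (u + h) <= (dotv s u - g s + dotv s h + 2^-1 * dotv h h)%:E)%E.
Proof.
move=> [_ sg] su; apply: conjugate_le => w.
have := sg w s u su; rewrite enorm_sqr.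
have [e eE] : exists e, e = w - s by eexists.
have -> : dotv w (u + h) = dotv (s + e) (u + h) by rewrite eE [s + _]addrC subrK.
rewrite -eE => H; have := dotv_ge0 (e - h).
rewrite !dotvE (dotvC h e) (dotvC e u).
lra.
Qed.

(** The conjugate lies above its tangent of slope [s] and, by [conjugate_smooth], at most
    [|h|^2 / 2] above it; the difference quotients are squeezed to the coordinates of [s]. *)
Lemma grad_conjugateE g s u : strongly_convex1 g -> subgradient g s u ->
  grad_conjugate g u = s.
Proof.
move=> sg su; apply/matrixP => i j; rewrite (ord1 j) mxE.
set F := fun u => fine (conjugate g u).
have Fu : F u = dotv s u - g s by rewrite /F (conjugate_subgradient su).
have up h : F (u + h) <= F u + dotv s h + 2^-1 * dotv h h.
  rewrite Fu -lee_fin /F fineK; first exact: conjugate_smooth.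
  have [s' /conjugate_subgradient ->] := strongly_convex_argmax (u + h) sg.
  by [].
have lo h : F u + dotv s h <= F (u + h).
  rewrite Fu /F; have := conjugate_ge g (u + h) s.
  have [s' /conjugate_subgradient ->] := strongly_convex_argmax (u + h) sg.
  by rewrite lee_fin dotvDr /=; lra.
apply: cvg_lim => //=.
apply/(@cvgrPdist_le _ R^o _ (0^')) => e e0.
near=> h.
have h0 : h != 0 by near: h; exact: nbhs_dnbhs_neq.
have he : `|h| <= e.
  near: h; apply: dnbhs0_le => //.
have := up (h *: delta_mx i 0); have := lo (h *: delta_mx i 0).
rewrite !dotvZr !dotvZl !dotv_delta mxE !eqxx mulr1.
rewrite [in X in X -> _]addrC [in X in _ -> X -> _](addrC (F u)) => l1 l2.
rewrite -[s i 0](mulKf h0) -mulrBr normrM normfV ler_pdivrMl ?normr_gt0//.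
rewrite [_ *: _ + u]addrC; move: l1 l2; set D := F u; set E := F (u + _) => l1 l2.
have hh : h * h = `|h| * `|h| by rewrite -!expr2 real_normK ?num_real.
have : `|h| * `|h| <= `|h| * e by rewrite ler_wpM2l.
have : 0 <= `|h| * e by rewrite mulr_ge0// ltW.
by rewrite ler_norml; rewrite hh in l2; lra.
Unshelve. all: by end_near. Qed.

End StronglyConvex.

(** * The weights v *)

Section LambdaMax.
Variables (R : realType) (k : nat).
Implicit Types (x y z v s : 'cV[R]_k) (M : 'M[R]_k).

Lemma continuous_mulmx_coord M i : continuous (fun x => (M *m x) i 0 : R^o).
Proof.
have -> : (fun x => (M *m x) i 0 : R^o) = (fun x => dotv (row i M)^T x : R^o).
  by apply/funext => x; rewrite mxE; apply: eq_bigr => j _; rewrite !mxE.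
apply: (@continuous_dotv _ _ (fun=> (row i M)^T) id) => j.
  by move=> y; apply: cvg_cst; exact: nbhs_filter.
exact: continuous_coord.
Qed.

Lemma rayleigh_max M : (0 < k)%N ->
  exists2 s, dotv s s = 1 & forall y, dotv y (M *m y) <= dotv s (M *m s) * dotv y y.
Proof.
move=> k0.
pose S := [set x : 'cV[R]_k | forall i, `|x i 0| <= 1] `&`
          (fun x => dotv x x) @^-1` [set 1 : R].
have cS : compact S.
  apply: compact_closedI; first exact: compact_cube.
  apply: closed_comp; last exact: (@closed_eq _ 1).
  move=> x _; apply: (@continuous_dotv _ _ id id); exact: continuous_coord.
have S0 : S !=set0.
  exists (delta_mx (Ordinal k0) 0); split => /=.
    by move=> i; rewrite mxE; case: (_ && _); rewrite ?normr1 ?normr0 ?ler01.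
  by rewrite dotv_delta mxE !eqxx.
have cf : continuous (fun x => dotv x (M *m x) : R^o).
  apply: (@continuous_dotv _ _ id (mulmx M)); first exact: continuous_coord.
  exact: continuous_mulmx_coord.
have [|s sS smax] := compact_EVT_max S0 cS (f := fun x => dotv x (M *m x)).
  exact: continuous_subspaceT.
move: sS; rewrite inE => -[_ /= s1]; exists s => // y.
have [->|y0] := eqVneq y 0; first by rewrite !dotv0l mulr0.
have yy : 0 < dotv y y by rewrite lt_neqAle eq_sym dotv_eq0 y0 dotv_ge0.
have e0 : 0 < enorm y by rewrite sqrtr_gt0.
have := smax ((enorm y)^-1 *: y).
have y1 : dotv ((enorm y)^-1 *: y) ((enorm y)^-1 *: y) = 1.
  by rewrite dotvZl dotvZr -enorm_sqr expr2 mulrA -invfM mulVf// mulf_neq0// gt_eqF.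
have -> : (enorm y)^-1 *: y \in S.
  rewrite inE; split => //= i.
  by rewrite (le_trans (abs_coord_le_enorm _ _))// /enorm y1 sqrtr1.
move=> /(_ isT); rewrite -scalemxAr dotvZl dotvZr mulrA -expr2 exprVn enorm_sqr.
by rewrite mulrC ler_pdivrMr.
Qed.

(* A maximiser of the Rayleigh quotient is an eigenvector. *)
Lemma lambda_max_rayleigh M x : M^T = M ->
  dotv x (M *m x) <= lambda_max M * dotv x x.
Proof.
move=> symM.
have [->|] := eqVneq x 0; first by rewrite !dotv0l mulr0.
have [k0|k0] := posnP k; first by move=> /eqP[]; apply/matrixP; case => i ik; exfalso; rewrite k0 in ik.
move=> _; have [s s1 smax] := rayleigh_max M k0.
set mu := dotv s (M *m s) in smax.
have [r rE] : exists r, r = mu *: s - M *m s by eexists.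
have r0 : r = 0.
  apply/eqP; rewrite -dotv_eq0 eq_le dotv_ge0 andbT.
  pose Q := mu * dotv r r - dotv r (M *m r).
  (* Maximality of [s] tested at [s + t *: r], with [r] the residual of the eigenvector equation. A
     nonzero [r] is contradicted at [t = -1] if [Q <= 0], and otherwise at the vertex
     [t = - |r|^2 / Q]. *)
  have Qge (t : R) : 0 <= 2 * t * dotv r r + t ^+ 2 * Q.
    have := smax (s + t *: r).
    have sr : dotv r (M *m s) = mu * dotv r s - dotv r r.
      by rewrite [X in _ = _ - dotv r X]rE dotvBr dotvZr opprB addrC subrK.
    have rs : dotv s (M *m r) = dotv r (M *m s) by rewrite dotv_mulmx symM dotvC.
    rewrite mulmxDr -scalemxAr !dotvE rs sr s1 (dotvC s r) -/mu /Q; lra.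
  rewrite leNgt; apply/negP => rr.
  have [Q0|Q0] := leP Q 0.
    by have := Qge (-1); rewrite sqrrN expr1n; lra.
  have := Qge (- (dotv r r / Q)); rewrite sqrrN exprMn.
  rewrite (_ : dotv r r ^+ 2 * _ * Q = dotv r r ^+ 2 / Q); last by field; rewrite gt_eqF.
  have : 0 < dotv r r ^+ 2 / Q by rewrite divr_gt0// exprn_gt0.
  rewrite (_ : 2 * - (dotv r r / Q) * dotv r r = - 2 * (dotv r r ^+ 2 / Q)); first lra.
  by field; rewrite gt_eqF.
have Ms : M *m s = mu *: s by apply/esym/eqP; rewrite -subr_eq0 -rE r0.
apply: le_trans (smax x) _; rewrite ler_wpM2r ?dotv_ge0//.
apply: ub_le_sup.
  (* [sup] is only informative on a bounded set: the maximal Rayleigh quotient bounds every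
     eigenvalue. Library eigenvectors are row vectors, hence the transposes. *)
  exists mu => a /= /eigenvalueP[u uM u0].
  have Mu : M *m u^T = a *: u^T by rewrite -[M]trmxK -trmx_mul symM uM linearZ.
  have := smax u^T; rewrite Mu dotvZr ler_pM2r//.
  by rewrite lt_neqAle eq_sym dotv_eq0 trmx_eq0 u0 dotv_ge0.
apply/eigenvalueP; exists s^T; first by rewrite -[M in LHS]symM -trmx_mul Ms linearZ.
by rewrite trmx_eq0 -dotv_eq0 s1 oner_eq0.
Qed.

End LambdaMax.

Section WeightMatrix.
Variables (R : realType) (n d m c : nat).
Variables (A : 'I_n -> 'M[R]_(d, m)) (Part : 'I_c -> {set 'I_n}) (tau : nat).

Lemma distributed_v_ge i x :
  \sum_(j < d | omega' A Part j != 0%N) row_weight A Part tau j * (A i *m x) j 0 ^+ 2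
  <= distributed_v A Part tau i * dotv x x.
Proof.
have sym : (\sum_(j < d | omega' A Part j != 0%N) row_weight A Part tau j *:
     ((row j (A i))^T *m row j (A i)))^T = \sum_(j < d | omega' A Part j != 0%N)
     row_weight A Part tau j *: ((row j (A i))^T *m row j (A i)).
  by rewrite linear_sum; apply: eq_bigr => j _; rewrite linearZ /= trmx_mul trmxK.
apply: le_trans (lambda_max_rayleigh x sym).
rewrite mulmx_suml dotv_sumr le_eqVlt; apply/orP; left; apply/eqP.
apply: eq_bigr => j _; rewrite -scalemxAl dotvZr -mulmxA dotv_mulmx trmxK.
congr (_ * _); rewrite /dotv big_ord1 expr2.
by rewrite -row_mul !mxE.
Qed.

End WeightMatrix.

Section ESO.
Variables (R : realType) (n d m c tau : nat) (A : 'I_n -> 'M[R]_(d, m)).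
Variables (Part : 'I_c -> {set 'I_n}).
Hypothesis Part_partition : equipartition Part.
Hypothesis tau_bounds : (1 <= tau <= n %/ c)%N.
Hypothesis c_dvd_n : (c %| n)%N.
Implicit Types (f : {ffun 'I_c -> {set 'I_n}}).

Local Notation rho := (marginal R n c tau).
Local Notation W := (block_weight R tau Part).
Local Notation v := (distributed_v A Part tau).

Lemma block_size : (n %/ c)%:R = n%:R / c%:R :> R.
Proof. by rewrite -natf_div. Qed.

Lemma marginalE : rho = tau%:R * c%:R / n%:R.
Proof. by rewrite /marginal block_size invf_div mulrA. Qed.

Lemma marginal_gt0 : 0 < rho.
Proof. by rewrite divr_gt0// ltr0n; case/andP: tau_bounds => // t1 /(leq_trans t1). Qed.

Lemma marginal_le1 : rho <= 1.
Proof.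
case/andP: tau_bounds => t1 t2.
by rewrite ler_pdivrMr ?mul1r ?ler_nat// ltr0n (leq_trans t1).
Qed.

(** Both corrections to 1 are nonnegative, since [block_ratio] lies between 0 and the marginal and a
    row met by some block has [omega] and [omega'] at least 1. This gives nonnegative [v]. *)
Lemma row_weight_ge1 j : omega' A Part j != 0%N -> 1 <= row_weight A Part tau j.
Proof.
move=> w'; have /card_gt0P[l] : (0 < omega' A Part j)%N by rewrite lt0n.
rewrite inE => /existsP[i /andP[iP Ai]].
have w0 : 1 <= (omega A j)%:R :> R.
  by rewrite ler1n; apply/card_gt0P; exists i; rewrite inE.
have w1 : 1 <= (omega' A Part j)%:R :> R by rewrite ler1n lt0n.
have b0 := pair_factor_ge0 R Part_partition tau_bounds l.
have b1 := pair_factor_le R Part_partition tau_bounds l.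
rewrite /row_weight -marginalE.
have -> : block_ratio R n c tau = pair_factor R n c tau.
  by rewrite /block_ratio -block_size.
rewrite -addrA lerDl; apply: addr_ge0; first by rewrite mulr_ge0// subr_ge0.
by rewrite mulr_ge0// mulr_ge0 ?divr_ge0// subr_ge0.
Qed.

Lemma distributed_v_ge0 i : (0 < m)%N -> 0 <= v i.
Proof.
move=> m0; pose x : 'cV[R]_m := delta_mx (Ordinal m0) 0.
have := distributed_v_ge A Part tau i x.
rewrite dotv_delta mxE !eqxx mulr1; apply: le_trans.
by apply: sumr_ge0 => j w'; rewrite mulr_ge0 ?sqr_ge0// (le_trans ler01)// row_weight_ge1.
Qed.

Lemma expected_separable_overapproximation (h : 'I_n -> 'cV[R]_m) :
  \sum_f W f * dotv (\sum_(i in sampled f) A i *m h i)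
                               (\sum_(i in sampled f) A i *m h i) <=
  \sum_i rho * v i * dotv (h i) (h i).
Proof.
pose x j i : R := (A i *m h i) j 0.
have xE j f : (\sum_(i in sampled f) A i *m h i) j 0 = \sum_(i in sampled f) x j i.
  by rewrite summxE.
have x0 j i : row j (A i) = 0 -> x j i = 0.
  move=> Aj; have -> : x j i = (row j (A i *m h i)) 0 0 by rewrite [RHS]mxE.
  by rewrite row_mul Aj mul0mx mxE.
(* The blocks cover all indices, so a row met by no block is zero throughout; omitting it from the
   weight matrix loses nothing. *)
have w'0 j i : omega' A Part j = 0%N -> x j i = 0.
  move=> /eqP; rewrite cards_eq0 => /eqP w'; apply/x0/eqP.
  have [l [il _]] := Part_partition.1 i.
  have /negbT : (l \in [set l | [exists i in Part l, row j (A i) != 0]]%SET) = false.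
    by rewrite w' inE.
  by rewrite inE negb_exists => /forallP/(_ i); rewrite il /= negbK.
apply: (@le_trans _ _ (\sum_j \sum_f W f * (\sum_(i in sampled f) x j i) ^+ 2)).
  rewrite le_eqVlt; apply/orP; left; apply/eqP; rewrite exchange_big.
  by apply: eq_bigr => f _ /=; rewrite -mulr_sumr; congr (_ * _); apply: eq_bigr => j _; rewrite xE.
apply: (@le_trans _ _ (\sum_(j | omega' A Part j != 0%N)
    rho * (row_weight A Part tau j * \sum_i x j i ^+ 2))).
  rewrite [leRHS]big_mkcond; apply: ler_sum => j _; case: ifPn => [w'|]; last first.
    rewrite negbK => /eqP w'; rewrite big1// => f _; rewrite big1 ?expr0n ?mulr0// => i _.
    exact: w'0.
  pose N := [set i | row j (A i) != 0]%SET.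
  pose L := [set l | [exists i in Part l, row j (A i) != 0]]%SET.
  have L0 : L != finset.set0 by rewrite -cards_eq0.
  have xN i : i \notin N -> x j i = 0 by rewrite inE negbK => /eqP/x0.
  have xL l i : l \notin L -> i \in Part l -> x j i = 0.
    rewrite inE negb_exists => /forallP/(_ i) + il; rewrite il /= negbK => /eqP.
    exact: x0.
  apply: le_trans (sum_block_weight_sqr_le Part_partition tau_bounds L0 xN xL) _.
  rewrite /row_weight -marginalE (_ : block_ratio R n c tau = pair_factor R n c tau)//.
  by rewrite /block_ratio -block_size.
rewrite -mulr_sumr; under [leRHS]eq_bigr do rewrite -mulrA.
rewrite -mulr_sumr ler_wpM2l ?(ltW marginal_gt0)//.
under eq_bigr do rewrite mulr_sumr; rewrite exchange_big /=.
by apply: ler_sum => i _; exact: distributed_v_ge.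
Qed.

Definition sampling_prob (s : {set 'I_n}) : R := \sum_(f | sampled f == s) W f.

Lemma sampling_prob_ge0 s : 0 <= sampling_prob s.
Proof. by apply: sumr_ge0 => f _; exact: block_weight_ge0. Qed.

Lemma sum_sampling_prob (F : {set 'I_n} -> R) :
  \sum_s sampling_prob s * F s = \sum_f W f * F (sampled f).
Proof.
rewrite [RHS](partition_big (@sampled n c) xpredT)//=; apply: eq_bigr => s _.
by rewrite mulr_suml; apply: eq_bigr => f /eqP ->.
Qed.

Lemma sum_sampling_prob1 : \sum_s sampling_prob s = 1.
Proof.
have := sum_sampling_prob (fun=> 1); rewrite -!mulr_suml !mulr1 => ->.
exact: sum_block_weight.
Qed.

Lemma sum_sampling_prob_mem (x : 'I_n -> R) :
  \sum_s sampling_prob s * (\sum_(i in s) x i) = rho * \sum_i x i.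
Proof. by rewrite (sum_sampling_prob (fun s => \sum_(i in s) x i)) sum_block_weight_mem. Qed.

End ESO.

(** * Laws of the samplings *)

Section FiniteRandomVariable.
Variables (dT : measure_display) (T : measurableType dT) (R : realType).
Variables (P : probability T R) (J : finType) (Y : T -> J).
Hypothesis mY : forall j, measurable [set x | Y x = j].

Lemma ge0_integral_finite_rv (F : J -> R) : (forall j, 0 <= F j) ->
  (\int[P]_x (F (Y x))%:E = \sum_j (F j)%:E * P [set x | Y x = j])%E.
Proof.
move=> F0.
have E x : (F (Y x))%:E = (\sum_j (F j)%:E * (\1_[set x | Y x = j] x)%:E)%E.
  rewrite (bigD1 (Y x))//= big1 => [|j /eqP jY].
    by rewrite indicE mem_set// mule1 adde0.
  by rewrite indicE memNset ?mule0//= => /esym.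
under eq_integral do rewrite E.
rewrite ge0_integral_sum//.
- apply: eq_bigr => j _; rewrite ge0_integralZl_EFin//; last exact/measurable_EFinP.
  by rewrite integral_indic// setIT.
- by move=> j; apply: measurable_funeM; exact/measurable_EFinP.
- by move=> j x _; rewrite mule_ge0// lee_fin.
Qed.

Lemma finite_rv_measurable (B : pred J) : measurable [set x | B (Y x)].
Proof.
rewrite (_ : [set x | _] = \bigcup_(j in [set j | B j]) [set x | Y x = j]).
  exact: fin_bigcup_measurable.
by apply/seteqP; split => x /=; [exists (Y x)|move=> [j /= Bj ->]].
Qed.

Lemma finite_rv_prob (B : pred J) :
  P [set x | B (Y x)] = (\sum_(j | B j) P [set x | Y x = j])%E.
Proof.
have := ge0_integral_finite_rv (fun j => ler0n R (B j)).
rewrite (_ : (fun x => _) = (fun x => (\1_[set x | B (Y x)] x)%:E)); last first.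
  by apply/funext => x; rewrite indicE; congr ((nat_of_bool _)%:R%:E); apply/idP/idP; rewrite inE.
rewrite integral_indic//; last exact: finite_rv_measurable.
rewrite setIT => ->; rewrite [RHS]big_mkcond; apply: eq_bigr => j _ /=.
by case: (B j); rewrite ?mul1e ?mul0e.
Qed.

(* [G] is not assumed measurable: this follows from its factorisation. *)
Lemma ge0_integral_factor (G : T -> R) : (forall x, 0 <= G x) ->
  (forall x y, Y x = Y y -> G x = G y) ->
  exists F : J -> R, [/\ forall x, F (Y x) = G x, forall j, 0 <= F j &
    (\int[P]_x (G x)%:E = \sum_j (F j)%:E * P [set x | Y x = j])%E].
Proof.
move=> G0 GY.
(* The value at any chosen outcome of the fibre, and 0 on values that [Y] never takes, whose
   probability is 0. *)
pose F j := if pselect (exists x, Y x = j) is left e then G (projT1 (cid e)) else 0.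
have FY x : F (Y x) = G x.
  rewrite /F; case: pselect => [e|]; last by case; exists x.
  by apply: GY; exact: (projT2 (cid e)).
have F0 j : 0 <= F j by rewrite /F; case: pselect.
exists F; split => //; rewrite -ge0_integral_finite_rv//.
by apply: eq_integral => x _; rewrite FY.
Qed.

End FiniteRandomVariable.

Section SamplingLaw.
Variables (R : realType) (n c tau : nat) (Part : 'I_c -> {set 'I_n}).
Hypothesis Part_partition : equipartition Part.
Variables (dX : measure_display) (X : measurableType dX) (PX : probability X R).
Variables (Shat : X -> {set 'I_n}).
Hypothesis Shat_sampling : distributed_sampling PX tau Part Shat.

(** The tuple of block draws has law [block_weight] by independence, and [Shat] is its image under
    union; from here on the abstract sampling is a finite sum. *)
Lemma distributed_sampling_prob (B : pred {set 'I_n}) :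
  PX [set x | B (Shat x)] = (\sum_(s | B s) sampling_prob R tau Part s)%:E.
Proof.
have [Sl [unif indep ShatE]] := Shat_sampling.
pose Y x : {ffun 'I_c -> {set 'I_n}} := [ffun l => Sl l x].
have YE f : [set x | Y x = f] = [set x | forall l, l \in enum 'I_c -> [set f l] (Sl l x)].
  apply/seteqP; split => x /=; first by move=> <- l _; rewrite ffunE.
  by move=> H; apply/ffunP => l; rewrite ffunE; apply: H; rewrite mem_enum.
have mY f : measurable [set x | Y x = f].
  rewrite YE (_ : [set x | _] = \bigcap_(l in setT) [set x | Sl l x = f l]).
    by apply: fin_bigcap_measurable => // l _; exact: (unif l).1.
  apply/seteqP; split => x /= H l; first by move=> _; apply: H; rewrite mem_enum.
  by move=> _; exact: H.
have PY f : PX [set x | Y x = f] = (block_weight R tau Part f)%:E.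
  rewrite YE (indep (enum 'I_c) (fun l => [set f l])) ?enum_uniq// /block_weight -prodEFin big_enum.
  by apply: eq_bigr => l _; rewrite (unif l).2 /uniform_weight; case: ifP.
have -> : [set x | B (Shat x)] = [set x | (B \o (@sampled n c)) (Y x)].
  apply/seteqP; split => x /=; rewrite ShatE /sampled.
    by under [in X in _ -> X]eq_bigr do rewrite ffunE.
  by under eq_bigr do rewrite ffunE.
rewrite (finite_rv_prob _ mY) (eq_bigr _ (fun f _ => PY f)) sumEFin; congr _%:E.
rewrite (partition_big (@sampled n c) B)//=; apply: eq_bigr => s Bs.
by apply: eq_bigl => f; case: eqP => [->|]; rewrite ?Bs ?andbT ?andbF.
Qed.

End SamplingLaw.

(** * Finite histories of independent draws *)

Section History.
Variables (R : realType) (n : nat).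
Variables (dO : measure_display) (Omega : measurableType dO).
Variables (P : probability Omega R) (S : nat -> Omega -> {set 'I_n}).
Hypotheses (mS : forall t, random_set (S t)) (indep : mutually_independent P S).

Definition history t x : {ffun 'I_t -> {set 'I_n}} := [ffun i : 'I_t => S i x].

(** Independence is stated for draws indexed by [nat], while [h] is indexed by ['I_t]. Quantifying
    over the ordinals of value [i] avoids a cast, and is vacuous when [i >= t]. *)
Let B t (h : {ffun 'I_t -> {set 'I_n}}) (i : nat) : set {set 'I_n} :=
  [set s | forall k : 'I_t, val k = i -> s = h k].

Let historyE t h : [set x | history t x = h] =
  [set x | forall i, i \in iota 0 t -> B h i (S i x)].
Proof.
apply/seteqP; split => x /=.
  by move=> <- i _ k <-; rewrite ffunE.
move=> H; apply/ffunP => k; rewrite ffunE; apply: H => //.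
by rewrite mem_iota/=.
Qed.

Lemma measurable_history t h : measurable [set x | history t x = h].
Proof.
rewrite (_ : [set x | _] = \bigcap_(k in [set: 'I_t]) [set x | S (val k) x = h k]).
  by apply: fin_bigcap_measurable => // k _; exact: mS.
apply/seteqP; split => x /=; first by move=> <- k _ /=; rewrite ffunE.
by move=> H; apply/ffunP => k; rewrite ffunE; exact: H.
Qed.

Lemma measurable_history_next t (hs : {ffun 'I_t -> {set 'I_n}} * {set 'I_n}) :
  measurable [set x | (history t x, S t x) = hs].
Proof.
case: hs => h s; rewrite (_ : [set x | _] = [set x | history t x = h] `&` [set x | S t x = s]).
  by apply: measurableI; [exact: measurable_history|exact: mS].
by apply/seteqP; split => x /= [-> ->].
Qed.

Lemma history_next_prob t (h : {ffun 'I_t -> {set 'I_n}}) s :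
  P [set x | (history t x, S t x) = (h, s)] =
  (P [set x | history t x = h] * P [set x | S t x = s])%E.
Proof.
pose C i : set {set 'I_n} := if (i < t)%N then B h i else [set s].
transitivity (P [set x | forall i, i \in iota 0 t.+1 -> C i (S i x)]).
  congr (P _); apply/seteqP; split => x.
    move=> [hx sx] i; rewrite mem_iota /= add0n ltnS leq_eqVlt /C.
    case/orP => [/eqP->|it]; first by rewrite ltnn.
    by rewrite it => k ki; rewrite -hx ffunE ki.
  move=> H; have {}H i : (i < t.+1)%N -> C i (S i x).
    by move=> it; apply: H; have := mem_iota 0 t.+1 i; rewrite add0n it => ->.
  congr (_, _).
    apply/ffunP => k; rewrite ffunE; have := H k (ltnW (ltn_ord k)).
    by rewrite /C ltn_ord; exact.
  by have := H t (leqnn _); rewrite /C ltnn; exact.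
rewrite indep ?iota_uniq// -addn1 iotaD big_cat/= big_seq1 add0n /C ltnn; congr (_ * _)%E.
rewrite historyE indep ?iota_uniq// [LHS]big_seq_cond [RHS]big_seq_cond.
by apply: eq_bigr => i; rewrite mem_iota add0n andbT /= => ->.
Qed.

End History.

(** * Contraction of the duality gap *)

Section QuartzStep.
Variables (R : realType) (n d m : nat).
Variables (phi : 'I_n -> 'cV[R]_m -> R) (g : 'cV[R]_d -> R).
Variables (A : 'I_n -> 'M[R]_(d, m)) (lambda gamma : R) (p v : 'I_n -> R).
Hypotheses (gamma_gt0 : 0 < gamma) (lambda_gt0 : 0 < lambda).
Hypothesis phi_convex : forall i, convex (phi i).
Hypothesis phi_smooth : forall i, lipschitz_gradient gamma^-1 (phi i).
Hypothesis g_strongly_convex : strongly_convex1 g.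
Hypothesis v_ge0 : forall i, 0 <= v i.
Hypothesis p_bounds : forall i, 0 < p i <= 1.
Local Notation theta := (quartz_theta lambda gamma p v).
Local Notation increment := (quartz_increment phi g A lambda gamma p v).

Lemma ord_natr_gt0 (i : 'I_n) : 0 < n%:R :> R.
Proof. by rewrite ltr0n (leq_trans _ (ltn_ord i)). Qed.

Lemma theta_ratio_ge0 i : 0 <= p i * lambda * gamma * n%:R / (v i + lambda * gamma * n%:R).
Proof.
have /andP[/ltW p0 _] := p_bounds i; have n0 := ltW (ord_natr_gt0 i).
by rewrite divr_ge0 ?addr_ge0 ?mulr_ge0// ltW.
Qed.

Lemma theta_le_ratio i : theta <= p i * lambda * gamma * n%:R / (v i + lambda * gamma * n%:R).
Proof.
by apply: ge_inf; [exists 0 => _ [k _ <-]; exact: theta_ratio_ge0|exists i].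
Qed.

Lemma theta_ge0 : (0 < n)%N -> 0 <= theta.
Proof.
move=> n0; apply: lb_le_inf.
  by exists (p (Ordinal n0) * lambda * gamma * n%:R / (v (Ordinal n0) + lambda * gamma * n%:R)); exists (Ordinal n0).
by move=> _ [k _ <-]; exact: theta_ratio_ge0.
Qed.

(** It places [theta / p i] in the unit interval, which makes the Option II update a convex
    combination. *)
Lemma theta_le_p i : theta <= p i.
Proof.
apply: le_trans (theta_le_ratio i) _; have /andP[p0 _] := p_bounds i.
have lgn : 0 < lambda * gamma * n%:R by rewrite !mulr_gt0// (ord_natr_gt0 i).
rewrite -!mulrA ler_piMr ?(ltW p0)// !mulrA ler_pdivrMr ?ltr_wpDl//.
by rewrite mul1r lerDr.
Qed.

(* The curvature [gamma] of the conjugates pays for the quadratic term. *)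
Lemma theta_curvature i (q := theta / p i) :
  v i * q / (lambda * n%:R) <= gamma * (1 - q).
Proof.
have /andP[p0 _] := p_bounds i; have nn := ord_natr_gt0 i.
have lgn : 0 < lambda * gamma * n%:R by rewrite !mulr_gt0.
have D0 : 0 < v i + lambda * gamma * n%:R by rewrite ltr_wpDl.
have := theta_le_ratio i; rewrite ler_pdivlMr// => H.
have {}H : q * (v i + lambda * gamma * n%:R) <= lambda * gamma * n%:R.
  by rewrite /q mulrAC ler_pdivrMr//; apply: le_trans H _; lra.
by rewrite ler_pdivrMr ?mulr_gt0//; lra.
Qed.

(* The bound is proved for the increment [d2] of Option II, to which the increment
   of Option I is compared. *)
Lemma increment_bound o i w abar a delta s alpha
    (q := theta / p i) (z := (A i)^T *m w) (G := gradient (phi i) z) :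
  subgradient g s abar -> conjugate (phi i) (- a) = alpha%:E ->
  increment o i w abar a delta ->
  exists2 b, conjugate (phi i) (- (a + delta)) = b%:E &
    dotv s (A i *m delta) + v i * dotv delta delta / (2 * lambda * n%:R) + b <=
    - q * dotv s (A i *m (a + G)) + (1 - q) * alpha + q * (dotv G z - phi i z).
Proof.
move=> sg phia inc.
have /andP[p0 _] := p_bounds i; have nn := ord_natr_gt0 i.
have q0 : 0 <= q by rewrite divr_ge0 ?(ltW p0)// theta_ge0// (leq_trans _ (ltn_ord i)).
have q1 : q <= 1 by rewrite ler_pdivrMr// mul1r theta_le_p.
(* With this choice [- (a + d2)] is the convex combination of [G] and [- a] with weights [q] and
   [1 - q]; the conjugate at [G] is explicit because [G] is a gradient. *)
pose d2 := - q *: (a + G).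
have [b2 phi2 b2le] : exists2 b, conjugate (phi i) (- (a + d2)) = b%:E &
    b <= q * (dotv G z - phi i z) + (1 - q) * alpha - gamma / 2 * (q * (1 - q)) * dotv (a + G) (a + G).
  have phiG : conjugate (phi i) G = (dotv G z - phi i z)%:E.
    rewrite (conjugate_subgradient (s := z)) ?(dotvC z)//.
    by apply: convex_gradient; [exact: (phi_smooth i).1|exact: phi_convex].
  have q01 : 0 <= q <= 1 by rewrite q0.
  have := conjugate_strongly_convex gamma_gt0 (phi_smooth i) phiG phia q01.
  rewrite (_ : q *: G + _ = - (a + d2)); last first.
    by apply/matrixP => k l; rewrite !mxE; ring.
  rewrite opprK (addrC G).
  have := conjugate_gtNy (phi i) (- (a + d2)).
  by case: conjugate => [b _|//|//]; rewrite lee_fin => ble; exists b.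
have {}b2le : dotv s (A i *m d2) + v i * dotv d2 d2 / (2 * lambda * n%:R) + b2 <=
    - q * dotv s (A i *m (a + G)) + (1 - q) * alpha + q * (dotv G z - phi i z).
  rewrite /d2 -scalemxAr !dotvZl !dotvZr.
  have e0 : 0 <= q / 2 * dotv (a + G) (a + G) by rewrite mulr_ge0 ?dotv_ge0// divr_ge0.
  have := ler_wpM2l e0 (theta_curvature i); rewrite -/q.
  have -> : v i * (- q * (- q * dotv (a + G) (a + G))) / (2 * lambda * n%:R) =
     q / 2 * dotv (a + G) (a + G) * (v i * q / (lambda * n%:R)).
    by field; rewrite !gt_eqF.
  lra.
case: o inc => [/(_ d2)|->]; last first.
  have -> : - (theta / p i) *: a - theta / p i *: gradient (phi i) ((A i)^T *m w) = d2.
    by rewrite /d2 !scaleNr scalerDr opprD.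
  by exists b2.
rewrite /optionI_objective (grad_conjugateE g_strongly_convex sg) phi2.
have := conjugate_gtNy (phi i) (- (a + delta)).
(* A maximiser cannot have conjugate value [+oo]: its objective would be [-oo], below the finite one
   at [d2]. *)
case: conjugate => [b _|_|//]; last by rewrite /= leeNy_eq.
rewrite !enorm_sqr -!EFinN -!EFinB lee_fin => H; exists b => //.
by apply: le_trans b2le; lra.
Qed.

(** For Option I, comparing two maximisers with their midpoint contradicts strong convexity of the
    conjugate unless they coincide. This is what makes the iterates functions of the sampled
    sets. *)
Lemma increment_unique o i w abar a delta delta' s alpha :
  subgradient g s abar -> conjugate (phi i) (- a) = alpha%:E ->
  increment o i w abar a delta -> increment o i w abar a delta' -> delta = delta'.
Proof.
move=> sg phia.
have [] : o = OptionII \/ o = OptionI by case: o; [right|left].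
  by move=> -> -> ->.
move=> -> inc inc'.
have [b phib _] := increment_bound sg phia inc.
have [b' phib' _] := increment_bound sg phia inc'.
pose mid := 2^-1 *: delta + (1 - 2^-1) *: delta'.
have h01 : 0 <= (2^-1 : R) <= 1 by lra.
have := conjugate_strongly_convex gamma_gt0 (phi_smooth i) phib phib' h01.
rewrite (_ : 2^-1 *: _ + _ = - (a + mid)); last first.
  by apply/matrixP => k l; rewrite !mxE; ring.
move: (inc mid) (inc' mid).
rewrite /optionI_objective (grad_conjugateE g_strongly_convex sg) phib phib'.
have := conjugate_gtNy (phi i) (- (a + mid)).
case: conjugate => [c _|//|//]; rewrite !enorm_sqr -!EFinN -!EFinB !lee_fin.
rewrite (_ : - (a + delta) - - (a + delta') = delta' - delta); last first.
  by apply/matrixP => k l; rewrite !mxE; ring.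
rewrite /mid mulmxDr -!scalemxAr.
have nn := ord_natr_gt0 i.
set K := 2 * lambda * n%:R; have K0 : 0 < K by rewrite /K !mulr_gt0.
rewrite ![_ * dotv _ _ / K]mulrAC.
have : 0 <= v i / K * dotv (delta' - delta) (delta' - delta).
  by rewrite mulr_ge0 ?dotv_ge0// divr_ge0// ltW.
set V := v i / K.
rewrite !dotvE (dotvC delta' delta).
set x := dotv delta delta; set y := dotv delta' delta'; set e := dotv delta delta'.
move=> V0 H1 H2 H3.
have : gamma * (x + y - 2 * e) <= 0 by lra.
rewrite pmulr_rle0// => H4.
apply/eqP; rewrite -subr_eq0 -dotv_eq0 eq_le dotv_ge0 andbT.
by rewrite !dotvE (dotvC delta' delta) -/x -/y -/e; lra.
Qed.

(** The gap [P - D] in real arithmetic; [fine] is faithful only when all the conjugates are finite,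
    as in [dual_gapE]. *)
Definition real_gap (w : 'cV[R]_d) (a : 'I_n -> 'cV[R]_m) : R :=
  primal phi g A lambda w + lambda * fine (conjugate g (dual_average A lambda a))
  + n%:R^-1 * \sum_i fine (conjugate (phi i) (- a i)).

(** One step from a fixed state, for any law [Q] with the stated linear moment and second-moment
    bound. An increment is supplied for every [i], since the average runs over all sets that might
    be drawn. *)
Lemma quartz_step (Q : {set 'I_n} -> R) o (w : 'cV[R]_d) a delta
    (abar := dual_average A lambda a)
    (w' := (1 - theta) *: w + theta *: grad_conjugate g abar) :
  (0 < n)%N -> (forall s, 0 <= Q s) -> \sum_s Q s = 1 ->
  (forall x : 'I_n -> R, \sum_s Q s * (\sum_(i in s) x i) = \sum_i p i * x i) ->
  (forall h : 'I_n -> 'cV[R]_m,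
    \sum_(s : {set 'I_n}) Q s * dotv (\sum_(i in s) A i *m h i) (\sum_(i in s) A i *m h i)
    <= \sum_i p i * v i * dotv (h i) (h i)) ->
  (forall i, conjugate (phi i) (- a i) \is a fin_num) ->
  (forall i, increment o i w' abar (a i) (delta i)) ->
  \sum_s Q s * real_gap w' (fun i => if i \in s then a i + delta i else a i)
  <= (1 - theta) * real_gap w a.
Proof.
move=> n0 Q0 Q1 Qlin Qeso afin inc.
have nn : 0 < n%:R :> R by rewrite ltr0n.
have nn0 : n%:R != 0 :> R by rewrite gt_eqF.
have l0 : lambda != 0 by rewrite gt_eqF.
have [sg sgu] := strongly_convex_argmax abar g_strongly_convex.
have gE := grad_conjugateE g_strongly_convex sgu.
have gu : fine (conjugate g abar) = dotv sg abar - g sg by rewrite (conjugate_subgradient sgu).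
pose al i := fine (conjugate (phi i) (- a i)).
have alE i : conjugate (phi i) (- a i) = (al i)%:E by rewrite fineK.
pose b i := fine (conjugate (phi i) (- (a i + delta i))).
pose z i := (A i)^T *m w'.
pose G i := gradient (phi i) (z i).
have bbound i : dotv sg (A i *m delta i) + v i * dotv (delta i) (delta i) / (2 * lambda * n%:R) + b i
    <= - (theta / p i) * dotv sg (A i *m (a i + G i)) + (1 - theta / p i) * al i
       + theta / p i * (dotv (G i) (z i) - phi i (z i)).
  by have [b' b'E] := increment_bound sgu (alE i) (inc i); rewrite /b b'E.
pose U (s : {set 'I_n}) := \sum_(i in s) A i *m delta i.
pose base := primal phi g A lambda w' + lambda * fine (conjugate g abar) + n%:R^-1 * \sum_i al i.
(* [y i] is the first-order change of the gap when [i] is drawn; [k] below is the second-order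
   coefficient [lambda / 2 * (lambda n)^-2]. *)
pose y i := n%:R^-1 * (dotv sg (A i *m delta i) + b i - al i).
pose k := (2 * lambda * n%:R ^+ 2)^-1.
have k0 : 0 <= k by rewrite invr_ge0 !mulr_ge0// ?sqr_ge0// ltW.
have stepS (s : {set 'I_n}) : real_gap w' (fun i => if i \in s then a i + delta i else a i) <=
    base + \sum_(i in s) y i + k * dotv (U s) (U s).
  rewrite /real_gap.
  have -> : dual_average A lambda (fun i => if i \in s then a i + delta i else a i) =
      abar + (lambda * n%:R)^-1 *: U s.
    rewrite /abar /dual_average -scalerDr; congr (_ *: _).
    rewrite /U [X in _ = _ + X]big_mkcond -big_split; apply: eq_bigr => i _ /=.
    by case: ifP => _; rewrite ?addr0// mulmxDr.
  have Hg : fine (conjugate g (abar + (lambda * n%:R)^-1 *: U s)) <=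
      fine (conjugate g abar) + (lambda * n%:R)^-1 * dotv sg (U s)
      + 2^-1 * ((lambda * n%:R)^-1 ^+ 2 * dotv (U s) (U s)).
    rewrite -lee_fin fineK; last first.
      have [s' /conjugate_subgradient ->] := strongly_convex_argmax (abar + (lambda * n%:R)^-1 *: U s) g_strongly_convex.
      by [].
    apply: le_trans (conjugate_smooth _ g_strongly_convex sgu) _.
    rewrite lee_fin gu !dotvZr !dotvZl; move: (_^-1 : R) => e.
    by rewrite le_eqVlt; apply/orP; left; apply/eqP; ring.
  have Hs : \sum_i fine (conjugate (phi i) (- (if i \in s then a i + delta i else a i)))
      = \sum_i al i + \sum_(i in s) (b i - al i).
    rewrite [X in _ = _ + X]big_mkcond -big_split; apply: eq_bigr => i _ /=.
    by case: ifP => _; rewrite ?addr0// /b addrC subrK.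
  have Hy : \sum_(i in s) y i = n%:R^-1 * (dotv sg (U s) + \sum_(i in s) (b i - al i)).
    rewrite /U dotv_sumr -big_split/= mulr_sumr; apply: eq_bigr => i _.
    by rewrite /y addrA.
  rewrite Hs Hy /base.
  have := ler_wpM2l (ltW lambda_gt0) Hg.
  have -> : lambda * (fine (conjugate g abar) + (lambda * n%:R)^-1 * dotv sg (U s)
      + 2^-1 * ((lambda * n%:R)^-1 ^+ 2 * dotv (U s) (U s))) =
      lambda * fine (conjugate g abar) + n%:R^-1 * dotv sg (U s) + k * dotv (U s) (U s).
    by rewrite /k; field; rewrite nn0 l0.
  by rewrite !mulrDr; lra.
apply: (@le_trans _ _ (\sum_s (Q s * base + Q s * (\sum_(i in s) y i) + k * (Q s * dotv (U s) (U s))))).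
  apply: ler_sum => s _; apply: le_trans (ler_wpM2l (Q0 s) (stepS s)) _.
  by rewrite !mulrDr [Q s * (k * _)]mulrCA.
rewrite !big_split/= -mulr_suml Q1 mul1r Qlin -mulr_sumr.
apply: le_trans (lerD (lexx _) (ler_wpM2l k0 (Qeso delta))) _.
(* After weighting by [p i], the fraction [theta / p i] becomes [theta] and the marginals
   disappear. *)
pose r i := theta * (- dotv sg (A i *m (a i + G i)) - al i + (dotv (G i) (z i) - phi i (z i))).
have Hr : \sum_i p i * y i + k * (\sum_i p i * v i * dotv (delta i) (delta i)) <=
    n%:R^-1 * \sum_i r i.
  rewrite !mulr_sumr -big_split; apply: ler_sum => i _ /=.
  have /andP[p0 _] := p_bounds i.
  have := ler_wpM2l (ltW p0) (bbound i) => Hb.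
  rewrite (_ : _ + _ = n%:R^-1 * (p i * (dotv sg (A i *m delta i) +
    v i * dotv (delta i) (delta i) / (2 * lambda * n%:R) + b i) - p i * al i)); last first.
    by rewrite /y /k; field; rewrite nn0 l0.
  apply: ler_wpM2l; first by rewrite invr_ge0 ltW.
  rewrite lerBlDr; apply: le_trans Hb _.
  rewrite le_eqVlt; apply/orP; left; apply/eqP; rewrite /r; field.
  by rewrite gt_eqF.
have Hr2 : n%:R^-1 * \sum_i r i = - (theta * lambda * dotv sg abar)
   - theta * (n%:R^-1 * \sum_i al i)
   + n%:R^-1 * \sum_i theta * (dotv (G i) ((A i)^T *m (w' - sg)) - phi i (z i)).
  rewrite -(mulrA theta lambda).
  have -> : lambda * dotv sg abar = n%:R^-1 * \sum_i dotv sg (A i *m a i).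
    by rewrite /abar /dual_average dotvZr dotv_sumr mulrA; congr (_ * _); field; rewrite nn0 l0.
  rewrite !mulr_sumr -!sumrN -!big_split; apply: eq_bigr => i _ /=.
  rewrite /r mulmxDr mulmxBr dotvBr dotvDr -/(z i) (dotv_mulmx (A i) sg (G i)).
  rewrite (dotvC _ (G i)); ring.
(* By definition of [w'], [theta (w' - sg) = (1 - theta) (w - w')], so the gradient term is the one
   in the tangent inequality of [phi i] between [z i] and the old point. *)
have Hphi : n%:R^-1 * \sum_i ((1 - theta) * phi i (z i) + theta * dotv (G i) ((A i)^T *m (w' - sg)))
    <= (1 - theta) * (n%:R^-1 * \sum_i phi i ((A i)^T *m w)).
  rewrite [leRHS]mulrCA; apply: ler_wpM2l; first by rewrite invr_ge0 ltW.
  rewrite mulr_sumr.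
  apply: ler_sum => i _.
  have := convex_gradient ((phi_smooth i).1 (z i)) (phi_convex i) ((A i)^T *m w).
  rewrite -/(G i) -mulmxBr => H.
  have t1 : 0 <= 1 - theta.
    have /andP[_ p1] := p_bounds i.
    by rewrite subr_ge0 (le_trans (theta_le_p i)).
  have := ler_wpM2l t1 H; rewrite mulrDr; apply: le_trans.
  rewrite lerD2l -!dotvZr !scalemxAr le_eqVlt; apply/orP; left; apply/eqP.
  congr (dotv _ (_ *m _)); rewrite /w' gE.
  by apply/matrixP => e1 e2; rewrite !mxE; ring.
have Hgw : g w' <= (1 - theta) * g w + theta * g sg.
  have t01 : 0 <= theta <= 1.
    rewrite theta_ge0//=; have /andP[_ p1] := p_bounds (Ordinal n0).
    exact: le_trans (theta_le_p _) p1.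
  have := convexP g_strongly_convex.1 sg w t01.
  by rewrite /w' gE addrC [X in _ <= X -> _]addrC.
rewrite -addrA; apply: le_trans (lerD (lexx _) Hr) _; rewrite Hr2 /base /real_gap -/abar gu /primal -/al.
have := ler_wpM2l (ltW lambda_gt0) Hgw.
move: Hphi; rewrite big_split/=.
rewrite -[\sum_i (theta * (_ - _))]mulr_sumr sumrB -!mulr_sumr.
rewrite /z; set PZ := \sum_i phi i _; set PW := \sum_i phi i _; set GG := \sum_i dotv _ _.
set AL := \sum_i al i; set gw := g w; set gw' := g w'; set gs := g sg.
set N := n%:R^-1; set T := theta.
lra.
Qed.

End QuartzStep.

(** * The extended-real gap and weak duality *)

Section Gap.
Variables (R : realType) (n d m : nat).
Variables (phi : 'I_n -> 'cV[R]_m -> R) (g : 'cV[R]_d -> R).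
Variables (A : 'I_n -> 'M[R]_(d, m)) (lambda : R).
Hypotheses (lambda_gt0 : 0 < lambda) (n_gt0 : (0 < n)%N).
Hypothesis g_strongly_convex : strongly_convex1 g.

Lemma conjugate_strongly_convex_fin u : conjugate g u \is a fin_num.
Proof. by have [s /conjugate_subgradient ->] := strongly_convex_argmax u g_strongly_convex. Qed.

Lemma dual_gapE w (a : 'I_n -> 'cV[R]_m) :
  (forall i, conjugate (phi i) (- a i) \is a fin_num) ->
  ((primal phi g A lambda w)%:E - dual phi g A lambda a)%E =
  (real_gap phi g A lambda w a)%:E.
Proof.
move=> afin; rewrite /dual -(fineK (conjugate_strongly_convex_fin _)).
under eq_bigr => i _ do rewrite -(fineK (afin i)).
by rewrite sumEFin -!EFinM -EFinN -!EFinB /real_gap; congr _%:E; ring.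
Qed.

Lemma dual_gap_pinfty w (a : 'I_n -> 'cV[R]_m) :
  ~ (forall i, conjugate (phi i) (- a i) \is a fin_num) ->
  ((primal phi g A lambda w)%:E - dual phi g A lambda a)%E = +oo%E.
Proof.
move=> /existsNP[i ai]; rewrite /dual -(fineK (conjugate_strongly_convex_fin _)).
have -> : (\sum_(i < n) conjugate (phi i) (- a i) = +oo)%E.
  apply/eqP; rewrite esum_eqy; last by move=> j _; rewrite gt_eqF// conjugate_gtNy.
  apply/existsP; exists i; move: ai; have := conjugate_gtNy (phi i) (- a i).
  by case: conjugate => // _ /(_ isT).
by rewrite gt0_muley// lte_fin invr_gt0 ltr0n.
Qed.

(** Fenchel-Young for [g] and for each [phi i]; the inner products cancel by definition of
    [dual_average]. Nonnegativity also lets the gap be integrated through [ge0_integral_factor]. *)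
Lemma weak_duality w (a : 'I_n -> 'cV[R]_m) :
  (forall i, conjugate (phi i) (- a i) \is a fin_num) ->
  0 <= real_gap phi g A lambda w a.
Proof.
move=> afin; rewrite /real_gap /primal.
have nn : n%:R != 0 :> R by rewrite pnatr_eq0 -lt0n.
have hg : dotv w (dual_average A lambda a) - g w <= fine (conjugate g (dual_average A lambda a)).
  by rewrite -lee_fin fineK ?conjugate_strongly_convex_fin// conjugate_ge.
have hphi : - (n%:R^-1 * \sum_i dotv w (A i *m a i)) - n%:R^-1 * \sum_i phi i ((A i)^T *m w)
    <= n%:R^-1 * \sum_i fine (conjugate (phi i) (- a i)).
  rewrite -mulrN -mulrBr ler_wpM2l ?invr_ge0// -sumrN -sumrB; apply: ler_sum => i _.
  by rewrite -lee_fin fineK// dotv_mulmx -dotvNr conjugate_ge.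
have := ler_wpM2l (ltW lambda_gt0) hg.
have -> : lambda * (dotv w (dual_average A lambda a) - g w) =
    n%:R^-1 * \sum_i dotv w (A i *m a i) - lambda * g w.
  rewrite mulrBr /dual_average dotvZr dotv_sumr mulrA; congr (_ * _ - _).
  by field; rewrite nn gt_eqF.
lra.
Qed.

End Gap.

(* [(1 - theta)^T G <= exp (- theta T) G <= exp (- ln (G / eps)) G = eps] *)
Lemma contraction_rate (R : realType) (theta K G eps : R) (T : nat) :
  0 <= theta <= 1 -> 1 <= theta * K -> 0 < eps -> eps <= G ->
  K * ln (G / eps) <= T%:R -> (1 - theta) ^+ T * G <= eps.
Proof.
move=> /andP[t0 t1] tK e0 eG KT.
have G0 : 0 < G by rewrite (lt_le_trans e0).
have L0 : 0 <= ln (G / eps) by rewrite ln_ge0// ler_pdivlMr// mul1r.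
have LT : ln (G / eps) <= theta * T%:R.
  have := ler_wpM2l t0 KT; have := ler_wpM2r L0 tK; rewrite mul1r mulrA.
  exact: le_trans.
have : (1 - theta) ^+ T <= expR (- ln (G / eps)).
  apply: (@le_trans _ _ (expR (- theta) ^+ T)).
    by rewrite lerXn2r ?nnegrE ?subr_ge0 ?expR_ge0// expR_ge1Dx.
  by rewrite -expRM_natr ler_expR mulNr lerN2.
rewrite expRN lnK ?posrE ?divr_gt0// invf_div => H.
by have := ler_wpM2r (ltW G0) H; rewrite divfK// gt_eqF.
Qed.

(** With marginals [tau c / n], each ratio in [quartz_theta] is the reciprocal of
    [n / (c tau) + v i / (lambda gamma c tau)], and the complexity dominates all of these sums. *)
Lemma theta_complexity (R : realType) (n c tau : nat) (lambda gamma : R) (v : 'I_n -> R) :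
  (0 < n)%N -> (0 < c)%N -> (0 < tau)%N -> 0 < lambda -> 0 < gamma -> (forall i, 0 <= v i) ->
  0 < quartz_complexity lambda gamma v c tau /\
  1 <= quartz_theta lambda gamma (fun=> tau%:R * c%:R / n%:R) v *
       quartz_complexity lambda gamma v c tau.
Proof.
move=> n0 c0 t0 l0 g0 v0.
have n0' : 0 < n%:R :> R by rewrite ltr0n.
have c0' : 0 < c%:R :> R by rewrite ltr0n.
have t0' : 0 < tau%:R :> R by rewrite ltr0n.
have D0 : 0 < lambda * gamma * c%:R * tau%:R by rewrite !mulr_gt0.
set V := range (fun i => v i / (lambda * gamma * c%:R * tau%:R)).
have Vub i : v i / (lambda * gamma * c%:R * tau%:R) <= sup V.
  apply: ub_le_sup; last by exists i.
  exists (\sum_i v i / (lambda * gamma * c%:R * tau%:R)) => _ [k _ <-].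
  by rewrite (bigD1 k)//= lerDl sumr_ge0// => j _; rewrite divr_ge0// ltW.
have K0 : 0 < quartz_complexity lambda gamma v c tau.
  rewrite ltr_wpDr ?divr_gt0 ?mulr_gt0//; apply: le_trans (Vub (Ordinal n0)).
  by rewrite divr_ge0// ltW.
split => //; rewrite -ler_pdivrMr// mul1r.
apply: lb_le_inf.
  by eexists; exists (Ordinal n0).
move=> _ [i _ <-].
have E : 0 < v i + lambda * gamma * n%:R by rewrite ltr_wpDl// !mulr_gt0.
rewrite -[leLHS]mul1r ler_pdivrMr//.
have X0 : 0 <= tau%:R * c%:R / n%:R * lambda * gamma * n%:R / (v i + lambda * gamma * n%:R).
  by rewrite ltW// divr_gt0// !mulr_gt0// invr_gt0.
apply: le_trans (ler_wpM2l X0 (lerD (lexx _) (Vub i))).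
rewrite le_eqVlt; apply/orP; left; apply/eqP; field.
by rewrite !gt_eqF.
Qed.

(** * Expected gap along a run *)

Section Run.
Variables (R : realType) (n d m : nat).
Variables (phi : 'I_n -> 'cV[R]_m -> R) (g : 'cV[R]_d -> R).
Variables (A : 'I_n -> 'M[R]_(d, m)) (lambda gamma : R) (p v : 'I_n -> R).
Hypotheses (gamma_gt0 : 0 < gamma) (lambda_gt0 : 0 < lambda) (n_gt0 : (0 < n)%N).
Hypothesis phi_convex : forall i, convex (phi i).
Hypothesis phi_smooth : forall i, lipschitz_gradient gamma^-1 (phi i).
Hypothesis g_strongly_convex : strongly_convex1 g.
Hypothesis v_ge0 : forall i, 0 <= v i.
Hypothesis p_bounds : forall i, 0 < p i <= 1.
Variables (Q : {set 'I_n} -> R).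
Hypotheses (Q_ge0 : forall s, 0 <= Q s) (Q_sum : \sum_s Q s = 1).
Hypothesis Q_lin : forall x : 'I_n -> R,
  \sum_s Q s * (\sum_(i in s) x i) = \sum_i p i * x i.
Hypothesis Q_eso : forall h : 'I_n -> 'cV[R]_m,
  \sum_(s : {set 'I_n}) Q s *
    dotv (\sum_(i in s) A i *m h i) (\sum_(i in s) A i *m h i)
  <= \sum_i p i * v i * dotv (h i) (h i).
Variables (dO : measure_display) (Omega : measurableType dO) (P : probability Omega R).
Variables (S : nat -> Omega -> {set 'I_n}).
Hypothesis S_random : forall t, random_set (S t.+1).
Hypothesis S_indep : mutually_independent P (fun t => S t.+1).
Hypothesis S_law : forall t s, P [set x | S t.+1 x = s] = (Q s)%:E.
Variables (o : quartz_option) (w0 : 'cV[R]_d) (alpha0 : 'I_n -> 'cV[R]_m).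
Variables (w abar : nat -> Omega -> 'cV[R]_d).
Variables (alpha delta : nat -> Omega -> 'I_n -> 'cV[R]_m).
Hypothesis run : forall x, quartz_run phi g A lambda gamma p v o w0 alpha0
  (fun t => S t x) (fun t => w t x) (fun t => abar t x)
  (fun t => alpha t x) (fun t => delta t x).
Hypothesis alpha0_fin : forall i, conjugate (phi i) (- alpha0 i) \is a fin_num.
Local Notation theta := (quartz_theta lambda gamma p v).
Local Notation H := (history (fun t => S t.+1)).

Lemma run_abar t x : abar t x = dual_average A lambda (alpha t x).
Proof.
elim: t => [|t IH].
  rewrite (quartz_abar0 (run x)) /dual_average; congr (_ *: _).
  by apply: eq_bigr => i _; rewrite (quartz_alpha0 (run x)).
rewrite (quartz_abar (run x)) IH /dual_average -scalerDr; congr (_ *: _).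
rewrite [X in _ + X]big_mkcond -big_split; apply: eq_bigr => i _ /=.
by rewrite (quartz_alpha (run x)); case: ifP => _; rewrite ?addr0// mulmxDr.
Qed.

Lemma run_fin t x i : conjugate (phi i) (- alpha t x i) \is a fin_num.
Proof.
elim: t => [|t IH]; first by rewrite (quartz_alpha0 (run x)).
rewrite (quartz_alpha (run x)); case: ifP => // iS.
have [s su] := strongly_convex_argmax (abar t x) g_strongly_convex.
have := increment_bound gamma_gt0 lambda_gt0 phi_convex phi_smooth g_strongly_convex
  v_ge0 p_bounds su (esym (fineK IH)) (quartz_delta (run x) iS).
by move=> [b ->].
Qed.

Lemma run_unique t i x a delta1 delta2 :
  conjugate (phi i) (- a) \is a fin_num ->
  quartz_increment phi g A lambda gamma p v o i (w t.+1 x) (abar t x) a delta1 ->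
  quartz_increment phi g A lambda gamma p v o i (w t.+1 x) (abar t x) a delta2 ->
  delta1 = delta2.
Proof.
move=> afin; have [s su] := strongly_convex_argmax (abar t x) g_strongly_convex.
exact: (increment_unique gamma_gt0 lambda_gt0 phi_convex phi_smooth g_strongly_convex
  v_ge0 p_bounds su (esym (fineK afin))).
Qed.

Lemma history_next t x y : H t.+1 x = H t.+1 y -> H t x = H t y /\ S t.+1 x = S t.+1 y.
Proof.
move=> /ffunP E; split.
  apply/ffunP => i; have := E (widen_ord (leqnSn t) i); rewrite !ffunE.
  exact.
by have := E ord_max; rewrite !ffunE.
Qed.

(** Induction on [t]: equal histories give equal states, and [run_unique] forces equal increments.
    The gap after [t] steps thus takes finitely many values. *)
Lemma run_determined t x y : H t x = H t y -> alpha t x = alpha t y /\ w t x = w t y.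
Proof.
elim: t => [_|t IH /history_next[/IH[ea ew] eS]].
  split; last by rewrite (quartz_w0 (run x)) (quartz_w0 (run y)).
  by apply/funext => i; rewrite (quartz_alpha0 (run x)) (quartz_alpha0 (run y)).
have eb : abar t x = abar t y by rewrite !run_abar ea.
have ew' : w t.+1 x = w t.+1 y by rewrite (quartz_w (run x)) (quartz_w (run y)) ew eb.
split => //; apply/funext => i.
rewrite (quartz_alpha (run x)) (quartz_alpha (run y)) eS ea; case: ifP => // iS.
have ix : i \in S t.+1 x by rewrite eS.
have := quartz_delta (run x) ix; have := quartz_delta (run y) iS.
rewrite ea -eb -ew' => d1 d2; congr (_ + _).
by apply: (run_unique _ d2 d1); rewrite -ea run_fin.
Qed.

Let gap t x := real_gap phi g A lambda (w t x) (alpha t x).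

Lemma gap_ge0 t x : 0 <= gap t x.
Proof. by apply: weak_duality => // i; exact: run_fin. Qed.

(** Since [p i > 0], some set of positive mass contains [i]; outcomes drawing it witness the
    increment of coordinate [i]. *)
Lemma sampling_support i : exists2 s : {set 'I_n}, i \in s & 0 < Q s.
Proof.
have /andP[p0 _] := p_bounds i.
have E : \sum_s Q s * (\sum_(k in s) (k == i)%:R) = p i.
  by rewrite Q_lin (bigD1 i)//= eqxx mulr1 big1 ?addr0// => k /negbTE ->; rewrite mulr0.
apply: contrapT => nex; move: p0; rewrite -E big1 ?ltxx// => s _.
have [si|/negP si] := boolP (i \in s).
  have : ~ 0 < Q s by move=> Qs; apply: nex; exists s.
  move/negP; rewrite -leNgt => Qs.
  by rewrite (_ : Q s = 0) ?mul0r//; apply/eqP; rewrite eq_le Qs Q_ge0.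
rewrite big1 ?mulr0// => k ks; case: eqP => // ki; by rewrite ki in ks.
Qed.

(** Both expectations are sums over histories, the left one also over the next set, with
    probabilities that factor by independence. It remains to apply [quartz_step] at each history of
    positive probability. *)
Lemma gap_contraction t :
  (\int[P]_x (gap t.+1 x)%:E <= (1 - theta)%:E * \int[P]_x (gap t x)%:E)%E.
Proof.
have gdet x y : H t x = H t y -> gap t x = gap t y.
  by move=> /run_determined[ea ew]; rewrite /gap ea ew.
have gdet' x y : (H t x, S t.+1 x) = (H t y, S t.+1 y) -> gap t.+1 x = gap t.+1 y.
  move=> [eH eS]; suff /run_determined[ea ew] : H t.+1 x = H t.+1 y by rewrite /gap ea ew.
  apply/ffunP => i; rewrite !ffunE; have [it|it] := ltnP i t.
    by have /ffunP/(_ (Ordinal it)) := eH; rewrite !ffunE.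
  by have -> : val i = t by apply/eqP; rewrite eqn_leq it -ltnS ltn_ord.
have [F [FE F0 ->]] := ge0_integral_factor P (measurable_history S_random (t := t)) (gap_ge0 t) gdet.
have [F' [FE' F0' ->]] := ge0_integral_factor P (measurable_history_next S_random (t := t)) (gap_ge0 t.+1) gdet'.
pose pi h := fine (P [set x | H t x = h]).
have piE h : P [set x | H t x = h] = (pi h)%:E.
  by rewrite fineK// fin_num_measure//; exact: measurable_history.
have pi0 h : 0 <= pi h by rewrite fine_ge0.
have jointE h s : P [set x | (H t x, S t.+1 x) = (h, s)] = (pi h * Q s)%:E.
  by rewrite (history_next_prob S_indep) piE S_law EFinM.
(* A pair of positive probability occurs at some outcome, where [run] can be used; pairs of
   probability 0 are discarded below. *)
have realize h s : 0 < pi h -> 0 < Q s -> exists x, H t x = h /\ S t.+1 x = s.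
  move=> h0 s0; apply: contrapT => nex.
  have : P [set x | (H t x, S t.+1 x) = (h, s)] = 0%E.
    rewrite (_ : [set x | _] = set0) ?measure0//.
    by apply/seteqP; split => x //= -[xh xs]; apply: nex; exists x.
  by move/eqP; rewrite jointE eqe mulf_eq0 !gt_eqF.
rewrite [X in (_ <= _ * X)%E](eq_bigr (fun h => (F h * pi h)%:E)); last first.
  by move=> h _; rewrite piE EFinM.
rewrite sumEFin -EFinM.
rewrite (eq_bigr (fun hs => (F' (hs.1, hs.2) * (pi hs.1 * Q hs.2))%:E)); last first.
  by move=> [h s] _; rewrite jointE EFinM.
rewrite sumEFin lee_fin.
rewrite -(pair_bigA _ (fun h s => F' (h, s) * (pi h * Q s))) /= mulr_sumr.
apply: ler_sum => h _.
have [->|h0] := eqVneq (pi h) 0.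
  by rewrite !mulr0 big1// => s _; rewrite mul0r mulr0.
have {}h0 : 0 < pi h by rewrite lt_neqAle eq_sym h0 pi0.
suff step : \sum_s Q s * F' (h, s) <= (1 - theta) * F h.
  rewrite mulrA -[leRHS]mulrC (le_trans _ (ler_wpM2l (pi0 h) step))//.
  by rewrite mulr_sumr; apply: ler_sum => s _; rewrite mulrC -mulrA.
(* Every [i] is sampled with positive probability, so its increment is realised on
   some path with history [h]; by uniqueness it is the same on all of them. *)
have /choice[X XP] : forall i, exists x, H t x = h /\ i \in S t.+1 x.
  move=> i; have [s si s0] := sampling_support i.
  by have [x [xh xs]] := realize h s h0 s0; exists x; rewrite xs.
pose x0 := X (Ordinal n_gt0).
have x0h : H t x0 = h by have [] := XP (Ordinal n_gt0).
have common x : H t x = h -> [/\ alpha t x = alpha t x0, w t x = w t x0,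
    abar t x = abar t x0 & w t.+1 x = w t.+1 x0].
  rewrite -x0h => /run_determined[ea ew].
  have eb : abar t x = abar t x0 by rewrite !run_abar ea.
  by split => //; rewrite (quartz_w (run x)) (quartz_w (run x0)) ew eb.
pose D i := delta t.+1 (X i) i.
have Dinc i : quartz_increment phi g A lambda gamma p v o i (w t.+1 x0) (abar t x0) (alpha t x0 i) (D i).
  have [Xh Xi] := XP i; have [ea _ eb ew'] := common _ Xh.
  by have := quartz_delta (run (X i)) Xi; rewrite ea eb ew'.
have := @quartz_step R n d m phi g A lambda gamma p v gamma_gt0 lambda_gt0 phi_convex
  phi_smooth g_strongly_convex v_ge0 p_bounds Q o (w t x0) (alpha t x0) D n_gt0
  Q_ge0 Q_sum Q_lin Q_eso (run_fin t x0).
rewrite -run_abar -(quartz_w (run x0)) => /(_ Dinc).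
rewrite -/(gap t x0) -FE x0h; apply: le_trans.
apply: ler_sum => s _; have [->|s0] := eqVneq (Q s) 0; first by rewrite !mul0r.
have {}s0 : 0 < Q s by rewrite lt_neqAle eq_sym s0 Q_ge0.
rewrite ler_pM2l//.
have [x [xh xs]] := realize h s h0 s0; have [ea _ eb ew'] := common x xh.
rewrite -xh -xs FE' /gap ew' le_eqVlt; apply/orP; left; apply/eqP.
congr real_gap; apply/funext => i; rewrite (quartz_alpha (run x)) ea; case: ifP => // iS.
congr (_ + _); have := quartz_delta (run x) iS; rewrite ea eb ew' => d1.
by apply: (run_unique _ d1 (Dinc i)); rewrite run_fin.
Qed.

Lemma theta_bounds : 0 <= theta <= 1.
Proof.
rewrite theta_ge0//=; have /andP[_ p1] := p_bounds (Ordinal n_gt0).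
by apply: le_trans p1; exact: theta_le_p.
Qed.

Lemma expected_gap_le T :
  (\int[P]_x ((primal phi g A lambda (w T x))%:E - dual phi g A lambda (alpha T x))
   <= ((1 - theta) ^+ T * real_gap phi g A lambda w0 alpha0)%:E)%E.
Proof.
under eq_integral => x _ do rewrite (dual_gapE _ _ g_strongly_convex _ (run_fin T x)).
rewrite -[X in (X <= _)%E]/(\int[P]_x (gap T x)%:E)%E.
elim: T => [|T IH].
  rewrite (_ : (fun x => _) = (fun=> (real_gap phi g A lambda w0 alpha0)%:E)).
    rewrite integral_cst// [X in (_ * X <= _)%E](_ : _ = 1%E); last exact: probability_setT.
    by rewrite mule1 expr0 mul1r.
  apply/funext => x; rewrite /gap (quartz_w0 (run x)); congr (real_gap _ _ _ _ _ _)%:E.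
  by apply/funext => i; rewrite (quartz_alpha0 (run x)).
apply: le_trans (gap_contraction T) _.
have /andP[_ t1] := theta_bounds.
by rewrite exprS -mulrA EFinM lee_wpmul2l// lee_fin subr_ge0.
Qed.

End Run.

Theorem corollary16 (R : realType) (n d m : nat)
  (phi : 'I_n -> 'cV[R]_m -> R) (g : 'cV[R]_d -> R)
  (A : 'I_n -> 'M[R]_(d, m)) (lambda gamma : R)
  (gamma_gt0 : 0 < gamma) (lambda_gt0 : 0 < lambda)
  (phi_convex : forall i, convex (phi i))
  (phi_smooth : forall i, lipschitz_gradient gamma^-1 (phi i))
  (g_strongly_convex : strongly_convex1 g)
  (A_neq0 : forall i, A i != 0)
  (c tau : nat) (c_ge1 : (1 <= c)%N) (c_dvd_n : (c %| n)%N)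
  (Part : 'I_c -> {set 'I_n}) (Part_partition : equipartition Part)
  (tau_bounds : (1 <= tau <= n %/ c)%N)
  (* the sampling Shat and its marginals *)
  (dX : measure_display) (X : measurableType dX) (PX : probability X R)
  (Shat : X -> {set 'I_n})
  (Shat_sampling : distributed_sampling PX tau Part Shat)
  (p : 'I_n -> R) (pE : forall i, (p i)%:E = PX [set x | i \in Shat x])
  (v : 'I_n -> R) (vE : forall i, v i = distributed_v A Part tau i)
  (* the run of Quartz *)
  (dO : measure_display) (Omega : measurableType dO) (P : probability Omega R)
  (S : nat -> Omega -> {set 'I_n})
  (S_iid : iid_copies P PX (fun t => S t.+1) Shat)
  (o : quartz_option) (w0 : 'cV[R]_d) (alpha0 : 'I_n -> 'cV[R]_m)
  (w abar : nat -> Omega -> 'cV[R]_d)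
  (alpha delta : nat -> Omega -> 'I_n -> 'cV[R]_m)
  (run : forall x, quartz_run phi g A lambda gamma p v o w0 alpha0
     (fun t => S t x) (fun t => w t x) (fun t => abar t x)
     (fun t => alpha t x) (fun t => delta t x))
  (eps : R) (eps_gt0 : 0 < eps)
  (eps_le : (eps%:E <= (primal phi g A lambda w0)%:E
                       - dual phi g A lambda alpha0)%E)
  (T : nat)
  (T_ge : ((quartz_complexity lambda gamma v c tau)%:E
             * lne (((primal phi g A lambda w0)%:E
                     - dual phi g A lambda alpha0) / eps%:E)
           <= (T%:R)%:E)%E) :
  (\int[P]_x ((primal phi g A lambda (w T x))%:E
              - dual phi g A lambda (alpha T x)) <= eps%:E)%E.
Proof.
have c0 : (0 < c)%N by [].
have /andP[t1 tnc] := tau_bounds.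
have n_gt0 : (0 < n)%N.
  by rewrite lt0n; apply: contraTneq (leq_trans t1 tnc) => ->; rewrite div0n.
(* A nonzero [A i] has a column; this provides the unit vector used to show [v i >= 0]. *)
have m_gt0 : (0 < m)%N.
  rewrite lt0n; apply: contra (A_neq0 (Ordinal n_gt0)) => /eqP m0.
  by apply/eqP/matrixP => i [j jm]; exfalso; rewrite m0 in jm.
have rho0 := marginal_gt0 R tau_bounds.
have rho1 := marginal_le1 R tau_bounds.
have rhoE := marginalE R tau c_dvd_n.
have p_rho i : p i = tau%:R * c%:R / n%:R.
  have := distributed_sampling_prob Shat_sampling (fun s => i \in s).
  rewrite -pE => -[->]; rewrite -rhoE.
  transitivity (\sum_s sampling_prob R tau Part s * (\sum_(k in s) (k == i)%:R)).
    rewrite big_mkcond; apply: eq_bigr => s _; rewrite big_mkcond (bigD1 i)//= eqxx.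
    rewrite big1 => [|k /negbTE ->]; last by rewrite if_same.
    by case: ifP => _; rewrite ?addr0 ?mulr1 ?mulr0.
  rewrite (sum_sampling_prob_mem Part_partition tau_bounds) (bigD1 i)//= eqxx.
  by rewrite big1 ?addr0 ?mulr1// => k /negbTE ->.
have p_bounds i : 0 < p i <= 1 by rewrite p_rho -rhoE rho0.
have v_ge0 i : 0 <= v i.
  by rewrite vE; exact: (distributed_v_ge0 A Part_partition tau_bounds c_dvd_n).
have [K0 thetaK] := theta_complexity n_gt0 c0 t1 lambda_gt0 gamma_gt0 v_ge0.
have [S_random S_indep S_law] := S_iid.
have law t s : P [set x | S t.+1 x = s] = (sampling_prob R tau Part s)%:E.
  rewrite S_law (_ : [set y | Shat y = s] = [set y | (pred1 s) (Shat y)]).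
    by rewrite (distributed_sampling_prob Shat_sampling) big_pred1_eq.
  by apply/seteqP; split => x /= /eqP.
(* Otherwise the initial gap is [+oo], so is its logarithm, and multiplying by the positive
   complexity contradicts the bound by [T]. *)
have fin0 : forall i, conjugate (phi i) (- alpha0 i) \is a fin_num.
  apply: contrapT => nfin; move: T_ge.
  rewrite (dual_gap_pinfty A lambda n_gt0 g_strongly_convex w0 nfin).
  have -> : (+oo / eps%:E = +oo :> \bar R)%E.
    by rewrite inver gt_eqF// gt0_mulye// lte_fin invr_gt0.
  by rewrite /= gt0_muley.
move: eps_le T_ge; rewrite (dual_gapE A lambda g_strongly_convex w0 fin0).
set gap0 := real_gap phi g A lambda w0 alpha0; rewrite lee_fin => eps_gap0.
rewrite inver gt_eqF// -EFinM lne_EFin ?divr_gt0 ?(lt_le_trans eps_gt0)// -EFinM lee_fin => KT.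
have Qlin (x : 'I_n -> R) : \sum_s sampling_prob R tau Part s * (\sum_(i in s) x i) = \sum_i p i * x i.
  rewrite (sum_sampling_prob_mem Part_partition tau_bounds) mulr_sumr.
  by apply: eq_bigr => i _; rewrite p_rho rhoE.
have Qeso (h : 'I_n -> 'cV[R]_m) : \sum_(s : {set 'I_n}) sampling_prob R tau Part s *
    dotv (\sum_(i in s) A i *m h i) (\sum_(i in s) A i *m h i)
    <= \sum_i p i * v i * dotv (h i) (h i).
  rewrite (sum_sampling_prob tau Part (fun s : {set 'I_n} =>
    dotv (\sum_(i in s) A i *m h i) (\sum_(i in s) A i *m h i))).
  apply: le_trans (expected_separable_overapproximation A Part_partition tau_bounds c_dvd_n h) _.
  by apply: ler_sum => i _; rewrite p_rho vE rhoE.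
have := expected_gap_le gamma_gt0 lambda_gt0 n_gt0 phi_convex phi_smooth
  g_strongly_convex v_ge0 p_bounds (@sampling_prob_ge0 R n c tau Part)
  (sum_sampling_prob1 R Part_partition tau_bounds) Qlin Qeso S_random S_indep law
  run fin0 T.
move/le_trans; apply; rewrite lee_fin.
apply: (contraction_rate _ _ eps_gt0 eps_gap0 KT).
  exact: (theta_bounds gamma_gt0 lambda_gt0 n_gt0 v_ge0 p_bounds).
by rewrite (_ : p = fun=> tau%:R * c%:R / n%:R)//; apply/funext.
Qed.
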